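(* For every $d\ge1$ there is a constant $C(d)>0$ depending only on $d$ such that the following holds. Let $h$ be a decreasing transformation, let $p=h\circ g\in\mathcal P(h)$ be a convex-transformed density on $\mathbb R^d$, and let $x_0\in\operatorname{ri}(\operatorname{dom} g)$ be the unique global minimum of $g$, such that $h$ is continuously differentiable at $g(x_0)$, $h'\circ g(x_0)\ne0$ and $\operatorname{curv}_{x_0}g>0$. Assume in addition that $g$ is locally Hölder continuous at $x_0$, that is, $|g(x)-g(x_0)|\le L\|x-x_0\|^\gamma$ for all $x$ in a neighborhood of $x_0$, with respect to some norm $\|\cdot\|$ on $\mathbb R^d$. Then, for the functional $T(h\circ g):=\operatorname{argmin} g$, there exists a sequence $\{p_n\}\subset\mathcal P(h)$ such that $$\liminf_{n\to\infty} n^{\frac{2}{\gamma(d+4)}}R_s(n;T,\{p,p_n\})\ \ge\ C(d)\,L^{-1/\gamma}\left[\frac{(h\circ g(x_0))^2\,\operatorname{curv}_{x_0}g}{(h'\circ g(x_0))^4}\right]^{\frac{1}{\gamma(d+4)}},$$ where the metric $s$ is $s(x,y)=\|x-y\|$.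
   Context: Write $\overline{\mathbb R}=[-\infty,+\infty]$, and let $a\asymp b$ mean that $a/b$ is bounded above and bounded away from $0$ in the indicated limit. A decreasing transformation is a nonincreasing $h:\overline{\mathbb R}\to[0,+\infty]$ with $h(-\infty)=+\infty$, $h(+\infty)=0$; put $y_0=\sup\{y:h(y)>0\}>y_\infty=\inf\{y:h(y)<\infty\}$. It is assumed that $h(y)=o(y^{-\alpha})$ as $y\to+\infty$ for some $\alpha>d$; that $h(y)\asymp(y-y_\infty)^{-\beta}$ as $y\downarrow y_\infty$ for some $\beta>d$ if $y_\infty>-\infty$; that $h(y)^{\gamma'} h(-Cy)=o(1)$ as $y\to-\infty$ for some $\gamma',C>0$ if $y_\infty=-\infty$; and that $h$ is continuously differentiable on $(y_\infty,y_0)$. The decreasing model $\mathcal P(h)$ is the family of bounded densities on $\mathbb R^d$ of the form $h\circ g$ with $g:\mathbb R^d\to(-\infty,+\infty]$ closed proper convex and $\dim(\operatorname{dom}g)=d$. ''Continuously differentiable at a point'' means continuously differentiable in a neighborhood of it. The functional $T$ is considered on densities $h\circ f\in\mathcal P(h)$ for which $f$ has a unique minimizer (and the $p_n$ are of this kind); $T(h\circ f)\in\mathbb R^d$ is that minimizer. Minimax risk: for a class $\mathcal Q$ of densities and a functional $T$ on $\mathcal Q$ with values in a metric space with metric $s$, $R_s(n;T,\mathcal Q)=\inf_{t_n}\sup_{q\in\mathcal Q}\mathbb E_{q^{\times n}}s(t_n(X_1,\dots,X_n),Tq)$, where $t_n$ ranges over all estimators (measurable functions of $X_1,\dots,X_n$)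 and $X_1,\dots,X_n$ are i.i.d. with density $q$ under $\mathbb E_{q^{\times n}}$. Curvature: for a positive definite $d\times d$ matrix $G$, a convex function $g$ is locally $G$-strongly convex at $x_0$ if there is a neighborhood $O(x_0)$ of $x_0$ and a convex function $q$ with $g(x)=\frac12(x-x_0)^TG(x-x_0)+q(x)$ on $O(x_0)$. Let $\mathcal{SC}(g;x_0)$ be the set of all such $G$. Then $\operatorname{curv}_{x_0}g=\sup\{\det G: G\in\mathcal{SC}(g;x_0)\}$, equal to $0$ if $\mathcal{SC}(g;x_0)$ is empty. (If $g$ is $C^2$ at $x_0$ with positive definite Hessian, then $\operatorname{curv}_{x_0}g=\det\nabla^2g(x_0)$.) *)

(* Defs.v *)
From HB Require Import structures.
From mathcomp Require Import all_boot all_order all_algebra.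
From mathcomp Require Import all_classical all_reals all_analysis.
From mathcomp Require Import measurable_realfun.

Set Implicit Arguments.
Unset Strict Implicit.
Unset Printing Implicit Defensive.

Import Order.TTheory GRing.Theory Num.Theory.
Import numFieldNormedType.Exports.

Local Open Scope classical_set_scope.
Local Open Scope ring_scope.

Section bij_pushforward.
Context d1 d2 (T1 : measurableType d1) (T2 : measurableType d2) (R : realType).
Variables (m : {measure set T1 -> \bar R}) (f : T1 -> T2) (g : T2 -> T1).
Hypothesis sfm : sigma_finite setT m.
Hypotheses (mf : measurable_fun setT f) (mg : measurable_fun setT g).
Hypothesis fK : cancel f g.

Definition bij_pushforward_fun := pushforward m f.
Local Notation mu := bij_pushforward_fun.

HB.instance Definition _ := Measure.copy mu
  (measure_function_pushforward__canonical__measure_function_Measure m mf).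

Let mu_sigma_finite : sigma_finite setT mu.
Proof.
have [F TF Foo] := sfm.
exists (fun k => g @^-1` F k).
  by rewrite -preimage_bigcup -TF preimage_setT.
move=> k; have [mFk Fkoo] := Foo k; split.
  by rewrite -[X in measurable X]setTI; exact: mg.
rewrite /bij_pushforward_fun /pushforward -comp_preimage.
by rewrite (_ : g \o f = id) //; exact/funext.
Qed.

HB.instance Definition _ := Measure_isSigmaFinite.Build _ _ _ mu mu_sigma_finite.

Definition bij_pushforward : {sigma_finite_measure set T2 -> \bar R} := mu.

End bij_pushforward.

Section product_measure.

Lemma sigma_finite_prod d1 d2 (T1 : measurableType d1) (T2 : measurableType d2)
    (R : realType) (m1 : {sigma_finite_measure set T1 -> \bar R})
    (m2 : {sigma_finite_measure set T2 -> \bar R}) :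
  sigma_finite setT (m1 \x m2)%E.
Proof.
have /sigma_finiteP[F [TF ndF Foo]] := sigma_finiteT m1.
have /sigma_finiteP[G [TG ndG Goo]] := sigma_finiteT m2.
exists (fun n => F n `*` G n).
  rewrite -setXTT TF TG predeqE => -[x y]; split.
    move=> [/= [n _ Fnx] [k _ Gky]]; exists (maxn n k) => //; split.
    - by move: x Fnx; exact/subsetPset/ndF/leq_maxl.
    - by move: y Gky; exact/subsetPset/ndG/leq_maxr.
  by move=> [n _ []/= ? ?]; split; exists n.
move=> k; have [? ?] := Foo k; have [? ?] := Goo k.
split; first exact: measurableX.
by rewrite product_measure1E// lte_mul_pinfty// ge0_fin_numE.
Qed.
Context d (T : measurableType d) (R : realType).
Variable m : {sigma_finite_measure set T -> \bar R}.

Definition tcons n (p : T * n.-tuple T) : n.+1.-tuple T := [tuple of p.1 :: p.2].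

Definition tuncons n (t : n.+1.-tuple T) : T * n.-tuple T :=
  (thead t, [tuple of behead t]).

Lemma measurable_tcons n : measurable_fun setT (@tcons n).
Proof. exact: measurable_cons. Qed.

Lemma measurable_tuncons n : measurable_fun setT (@tuncons n).
Proof.
apply: measurable_fun_pair; first exact: measurable_tnth.
exact: measurable_behead.
Qed.

Lemma tconsK n : cancel (@tcons n) (@tuncons n).
Proof.
case=> x t; rewrite /tuncons /tcons theadE /=; congr pair.
exact/val_inj.
Qed.

Fixpoint prod_measure n : {sigma_finite_measure set (n.-tuple T) -> \bar R} :=
  if n is n'.+1 then
    bij_pushforward (sigma_finite_prod m (prod_measure n'))
      (@measurable_tcons n') (@measurable_tuncons n') (@tconsK n')
  else \d_ [tuple].

End product_measure.

(* The sigma-algebra on R^d generated by the coordinates, i.e. the Borel one. *)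
Section measurable_rV.
Context (R : realType) (d : nat).

Let coord : 'I_d -> 'rV[R]_d -> R := fun i x => x ord0 i.

Let rV_set0 : g_sigma_preimage coord set0.
Proof. exact: sigma_algebra0. Qed.

Let rV_setC A : g_sigma_preimage coord A -> g_sigma_preimage coord (~` A).
Proof. exact: sigma_algebraC. Qed.

Let rV_bigcup (F : _^nat) : (forall i, g_sigma_preimage coord (F i)) ->
  g_sigma_preimage coord (\bigcup_i (F i)).
Proof. exact: sigma_algebra_bigcup. Qed.

HB.instance Definition _ :=
  @isMeasurable.Build (measure_tuple_display default_measure_display)
    'rV[R]_d (g_sigma_preimage coord) rV_set0 rV_setC rV_bigcup.

Definition row_of_tuple (t : d.-tuple (measurableTypeR R)) : 'rV[R]_d :=
  \row_i tnth t i.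

Definition tuple_of_row (x : 'rV[R]_d) : d.-tuple (measurableTypeR R) :=
  [tuple x ord0 i | i < d].

Lemma row_of_tupleK : cancel row_of_tuple tuple_of_row.
Proof. by move=> t; apply: eq_from_tnth => i; rewrite tnth_mktuple mxE. Qed.

Lemma tuple_of_rowK : cancel tuple_of_row row_of_tuple.
Proof. by move=> x; apply/rowP => i; rewrite mxE tnth_mktuple. Qed.

Lemma measurable_tuple_of_row : measurable_fun setT tuple_of_row.
Proof.
apply/measurable_fun_tnthP => i.
rewrite (_ : _ \o _ = coord i); last first.
  by apply/funext => x /=; rewrite tnth_mktuple.
move=> _ Y mY; rewrite setTI; apply: sub_sigma_algebra => /=.
rewrite -bigcup_seq/=; exists i => /=; first by rewrite mem_index_enum.
by exists Y => //; rewrite setTI.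
Qed.

Lemma measurable_row_of_tuple : measurable_fun setT row_of_tuple.
Proof.
have E : g_sigma_preimage (fun i => coord i \o row_of_tuple) `<=` measurable.
  rewrite (_ : (fun i => _) = fun i => @tnth d (measurableTypeR R) ^~ i) //.
  by apply/funext => i; apply/funext => t; rewrite /coord /= mxE.
move=> _ A mA; apply: E; rewrite g_sigma_preimage_comp.
by exists A.
Qed.

Definition lebesgue_rV : {sigma_finite_measure set 'rV[R]_d -> \bar R} :=
  bij_pushforward (sigma_finiteT (prod_measure (@lebesgue_measure R) d))
    measurable_row_of_tuple measurable_tuple_of_row row_of_tupleK.

End measurable_rV.

Section convex_analysis.
Context (R : realType) (d : nat).
Implicit Types (A : set 'rV[R]_d) (g : 'rV[R]_d -> \bar R) (x : 'rV[R]_d).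

Definition is_norm (N : 'rV[R]_d -> R) : Prop :=
  [/\ forall x y, N (x + y) <= N x + N y,
      forall (a : R) x, N (a *: x) = `|a| * N x &
      forall x, N x = 0 -> x = 0].

(* Convexity of an extended real-valued function; it is only used for functions
   that do not take the value -oo, for which both sides are unambiguous
   (recall that 0 * +oo = 0). *)
Definition econvex g : Prop :=
  forall (x y : 'rV[R]_d) (t : R), 0 <= t <= 1 ->
    (g (t *: x + (1 - t) *: y)%R <= t%:E * g x + (1 - t)%:E * g y)%E.

Definition edom g : set 'rV[R]_d := [set x | (g x < +oo)%E].

Definition aff_hull A : set 'rV[R]_d :=
  [set x | exists (k : nat) (c : 'I_k -> R) (a : 'I_k -> 'rV[R]_d),
    [/\ forall i, A (a i), \sum_i c i = 1 & x = \sum_i c i *: a i]].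

(* The affine hull of A is a k-dimensional affine subspace; the rows of M are a
   basis of its direction. *)
Definition has_dim A (k : nat) : Prop :=
  exists (a : 'rV[R]_d) (M : 'M[R]_(k, d)),
    row_free M /\ aff_hull A = [set a + u *m M | u in [set: 'rV[R]_k]].

Definition relint A : set 'rV[R]_d :=
  [set x | A x /\ within (aff_hull A) (nbhs x) A].

Definition closed_proper_convex g : Prop :=
  [/\ forall x, g x != -oo%E, edom g !=set0, econvex g &
      lower_semicontinuous g].

Definition unique_min g x : Prop := forall y, y != x -> (g x < g y)%E.

Definition posdefmx (G : 'M[R]_d) : Prop :=
  G^T = G /\ forall v : 'rV[R]_d, v != 0 -> 0 < (v *m G *m v^T) ord0 ord0.

Definition strongly_convex_at (G : 'M[R]_d) g (x0 : 'rV[R]_d) : Prop :=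
  exists2 q : 'rV[R]_d -> \bar R,
    (forall x, q x != -oo%E) /\ econvex q &
    \forall x \near x0,
      g x = ((2^-1 * ((x - x0) *m G *m (x - x0)^T) ord0 ord0)%R%:E + q x)%E.

Definition SC g (x0 : 'rV[R]_d) : set 'M[R]_d :=
  [set G | posdefmx G /\ strongly_convex_at G g x0].

(* The supremum may be +oo, e.g. for |x|^(3/2) at 0. *)
Definition curv (x0 : 'rV[R]_d) g : \bar R :=
  if SC g x0 == set0 then 0%E
  else ereal_sup [set (\det G)%:E | G in SC g x0].

End convex_analysis.

Section decreasing_transformation.
Context (R : realType).
Implicit Types (h : \bar R -> \bar R) (y : R).

(* h as a real function on R. It is meaningful only where h is finite, which is
   the case on (y_infty h, +oo), and at the values of g when h \o g is bounded. *)
Definition hreal h : R -> R := fun y => fine (h y%:E).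

Definition y_zero h : \bar R := ereal_sup [set y | (0 < h y)%E].
Definition y_infty h : \bar R := ereal_inf [set y | (h y < +oo)%E].

Definition C1_at h y : Prop :=
  \forall z \near y, [/\ h z%:E \is a fin_num, derivable (hreal h) z 1 &
                         {for z, continuous (derive1 (hreal h))}].

Definition asymp (F : set_system R) (a b : R -> R) : Prop :=
  exists c C : R, 0 < c /\ \forall y \near F, c <= a y / b y <= C.

Record decreasing_transformation (d : nat) h : Prop := {
  dt_ge0 : forall y : \bar R, (0 <= h y)%E ;
  dt_noninc : forall y z : \bar R, (y <= z)%E -> (h z <= h y)%E ;
  dt_Ny : h -oo%E = +oo%E ;
  dt_y : h +oo%E = 0%E ;
  dt_lt : (y_infty h < y_zero h)%E ;
  dt_right : exists2 alpha : R, d%:R < alpha &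
    hreal h y / y `^ (- alpha) @[y --> +oo] --> 0 ;
  dt_left_fin : forall yi : R, y_infty h = yi%:E ->
    exists2 beta : R, d%:R < beta &
      asymp yi^'+ (hreal h) (fun y => (y - yi) `^ (- beta)) ;
  dt_left_infty : y_infty h = -oo%E ->
    exists gamma' C : R, [/\ 0 < gamma', 0 < C &
      hreal h y `^ gamma' * hreal h (- C * y) @[y --> -oo] --> 0] ;
  dt_C1 : forall y, (y_infty h < y%:E < y_zero h)%E -> C1_at h y
}.

End decreasing_transformation.

Section model.
Context (R : realType) (d : nat).
Implicit Types (h : \bar R -> \bar R) (q : 'rV[R]_d -> \bar R).

Definition is_density q : Prop :=
  [/\ measurable_fun setT q, forall x, (0 <= q x)%E &
      (\int[@lebesgue_rV R d]_x q x = 1)%E].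

Definition bounded_density q : Prop :=
  is_density q /\ exists M : R, forall x, (q x <= M%:E)%E.

Definition admissible (g : 'rV[R]_d -> \bar R) : Prop :=
  closed_proper_convex g /\ has_dim (edom g) d.

Definition decreasing_model h : set ('rV[R]_d -> \bar R) :=
  [set q | bounded_density q /\ exists2 g, admissible g & q = h \o g].

(* A density may be written h \o f for several f, as h need not be injective.
   When h is strictly decreasing at the minimum of f, argmins h (h \o f) is the
   singleton of the minimizer of f; argmin_functional chooses an element of
   argmins h q in general. *)
Definition argmins h q : set 'rV[R]_d :=
  [set x | exists2 f, admissible f & q = h \o f /\ unique_min f x].

Definition argmin_functional h q : 'rV[R]_d := xget 0 (argmins h q).

(* The law of an n-sample with density q has density prod_i q(x_i) with respect
   to the n-fold product of the Lebesgue measure. *)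
Definition iid_expectation (n : nat) q (F : n.-tuple 'rV[R]_d -> \bar R) :=
  (\int[prod_measure (@lebesgue_rV R d) n]_x
     ((\prod_(i < n) q (tnth x i)) * F x))%E.

Definition minimax_risk (s : 'rV[R]_d -> 'rV[R]_d -> R) (n : nat)
    (T : ('rV[R]_d -> \bar R) -> 'rV[R]_d) (Q : set ('rV[R]_d -> \bar R)) :
    \bar R :=
  ereal_inf [set
    ereal_sup [set iid_expectation q (fun x => (s (t x) (T q))%:E) | q in Q]
  | t in [set t : n.-tuple 'rV[R]_d -> 'rV[R]_d | measurable_fun setT t]].

End model.

(* Main.v *)
(* Two-point method. If g(x1) <= g(x0) + eps, replace g near x0 by
   max(g - theta b, g(x0) + eps + eta N(x - x1)) with eta tiny and b a bump. The
   new minimizer is x1. By strong convexity g has been raised only on a sublevel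
   ellipsoid of volume O(eps^(d/2) / sqrt(det G)), and by at most 2 eps. The
   convexity of g - theta b is paid for by the quadratic part of g, and
   theta = O(eps^(1 + d/2)) is chosen (intermediate values) so that the total
   mass stays 1. The chi-square distance to p is thus of order
   h'^2 / h * eps^(2 + d/2) / sqrt(det G), and it equals 1/n for eps of order
   (h^2 det G / (h'^4 n^2))^(1/(d+4)). By the Hoelder condition x1 can be taken
   at distance (eps / L)^(1/gamma) from x0.

   Lowering g only near x0 matters: h may jump or be irregular far from g(x0), so
   that a global rescaling of p could be detected at the rate 1/n. *)
Require Import Defs.
From HB Require Import structures.
From mathcomp Require Import all_boot all_order all_algebra.
From mathcomp Require Import all_classical all_reals all_analysis.
From mathcomp Require Import measurable_realfun ring lra.

Import Order.TTheory GRing.Theory Num.Theory.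
Import numFieldNormedType.Exports.

Local Open Scope classical_set_scope.
Local Open Scope ring_scope.

(** * Positive definite quadratic forms *)

(** Strong convexity is known only near [x0], yet the deformed function must be closed and convex on
    the whole space, with the same effective domain. Convexity is checked on a ball of radius 2r and
    transported by gluing, since nothing has changed beyond radius r. Growth of [g] from its
    minimum, quadratic in the ball and hence linear beyond it, keeps the tilted norm below [g]
    outside. In the chi-square distance the compensation of mass must not dominate: it spreads a
    change of order eps times the volume of the ellipsoid over a fixed ball, so its square is of
    second order in that volume. As [h] need not be injective, the functional is read off the
    density through strictness of [h] at the minimal level. Two questions of uniformity shape the
    end. The constant may not depend on gamma, although a numerical factor is raised to the power
    1/gamma: for gamma < 1, convexity allows [L] to be decreased at will. And the curvature is a
    supremum, possibly infinite or not attained, while one sequence must serve all [G]: each density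
    is chosen nearly optimal for the risk itself, independently of [G]. *)

Section quadratic_form.
Context (R : realType).

Definition bform {d} (G : 'M[R]_d) (x y : 'rV[R]_d) : R :=
  (x *m G *m y^T) ord0 ord0.

Lemma bformDl d (G : 'M[R]_d) x y z :
  bform G (x + y) z = bform G x z + bform G y z.
Proof. by rewrite /bform !mulmxDl mxE. Qed.

Lemma bformDr d (G : 'M[R]_d) x y z :
  bform G z (x + y) = bform G z x + bform G z y.
Proof. by rewrite /bform linearD /= mulmxDr mxE. Qed.

Lemma bformZl d (G : 'M[R]_d) a x y : bform G (a *: x) y = a * bform G x y.
Proof. by rewrite /bform -!scalemxAl mxE. Qed.

Lemma bformZr d (G : 'M[R]_d) a x y : bform G x (a *: y) = a * bform G x y.
Proof. by rewrite /bform linearZ /= -scalemxAr mxE. Qed.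

Lemma bformC d (G : 'M[R]_d) x y : G^T = G -> bform G x y = bform G y x.
Proof.
move=> GT; have -> : bform G x y = (x *m G *m y^T)^T ord0 ord0 by rewrite mxE.
by rewrite !trmx_mul trmxK GT mulmxA.
Qed.

Lemma bform_ge0 d (G : 'M[R]_d) x : posdefmx G -> 0 <= bform G x x.
Proof.
move=> [_ Gpos]; have [->|x0] := eqVneq x 0; last exact/ltW/Gpos.
by rewrite /bform !mul0mx mxE.
Qed.

Lemma bform_CS d (G : 'M[R]_d) x y : posdefmx G ->
  bform G x y ^+ 2 <= bform G x x * bform G y y.
Proof.
move=> Gp; have [GT Gpos] := Gp; have [->|y0] := eqVneq y 0.
  by rewrite /bform !mul0mx trmx0 mulmx0 mxE expr0n /= mulr0.
have yy : 0 < bform G y y := Gpos _ y0.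
(* This vector is [bform G y y] times the part of [x] that is [G]-orthogonal to [y]. *)
have := bform_ge0 _ G (bform G y y *: x - bform G x y *: y) Gp.
rewrite -scaleNr bformDl !bformDr !bformZl !bformZr (bformC _ _ y x GT) => H.
have : 0 <= bform G y y * (bform G x x * bform G y y - bform G x y ^+ 2) by nra.
by rewrite pmulr_rge0 // subr_ge0.
Qed.

Definition gnorm {d} (G : 'M[R]_d) (x : 'rV[R]_d) : R := Num.sqrt (bform G x x).

Lemma gnorm_ge0 d (G : 'M[R]_d) x : 0 <= gnorm G x.
Proof. exact: sqrtr_ge0. Qed.

Lemma sqr_gnorm d (G : 'M[R]_d) x : posdefmx G -> gnorm G x ^+ 2 = bform G x x.
Proof. by move=> Gp; rewrite sqr_sqrtr //; exact: bform_ge0. Qed.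

Lemma gnorm_is_norm d (G : 'M[R]_d) : posdefmx G -> is_norm (gnorm G).
Proof.
move=> Gp; have [GT Gpos] := Gp; split=> [x y|a x|x].
- rewrite -(ler_pXn2r (ltn0Sn 1)) ?nnegrE ?addr_ge0 ?gnorm_ge0 //.
  rewrite sqrrD !sqr_gnorm // !bformDl !bformDr (bformC _ _ y x GT).
  suff : bform G x y <= gnorm G x * gnorm G y by lra.
  apply: le_trans (ler_norm _) _.
  rewrite -(ler_pXn2r (ltn0Sn 1)) ?nnegrE ?mulr_ge0 ?gnorm_ge0 //.
  by rewrite real_normK ?num_real // exprMn !sqr_gnorm //; exact: bform_CS.
- by rewrite /gnorm bformZl bformZr mulrA -expr2 sqrtrM ?sqr_ge0 // sqrtr_sqr.
- move=> x0; apply/eqP; apply: contraT => /Gpos.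
  by rewrite -[X in 0 < X]/(bform G x x) -sqr_gnorm // x0 expr0n /= ltxx.
Qed.

Lemma posdefmx_unit d (G : 'M[R]_d) : posdefmx G -> G \in unitmx.
Proof.
move=> [_ Gpos]; rewrite -row_free_unit -kermx_eq0; apply/rowV0P => v.
move/sub_kermxP => vG; apply/eqP; apply: contraT => /Gpos.
by rewrite vG mul0mx mxE ltxx.
Qed.

(* [x_i = bform G x (e_i G^-1)], so this is Cauchy-Schwarz. *)
Lemma coord_le_gnorm d (G : 'M[R]_d) (i : 'I_d) : posdefmx G ->
  exists2 K : R, 0 <= K & forall x : 'rV[R]_d, `|x ord0 i| <= K * gnorm G x.
Proof.
move=> Gp; have [GT _] := Gp.
exists (gnorm G (delta_mx 0 i *m invmx G)); first exact: gnorm_ge0.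
move=> x; have -> : x ord0 i = bform G x (delta_mx 0 i *m invmx G).
  rewrite /bform trmx_mul trmx_inv GT mulmxA mulmxK ?posdefmx_unit //.
  by rewrite trmx_delta -colE mxE.
rewrite -(ler_pXn2r (ltn0Sn 1)) ?nnegrE ?mulr_ge0 ?gnorm_ge0 //.
rewrite real_normK ?num_real // exprMn !sqr_gnorm // mulrC; exact: bform_CS.
Qed.

Lemma mx_norm_le_gnorm d (G : 'M[R]_d) : posdefmx G ->
  exists2 K : R, 0 < K & forall x : 'rV[R]_d, `|x| <= K * gnorm G x.
Proof.
move=> Gp.
have /choice[K HK] : forall i : 'I_d, exists K : R, 0 <= K /\
    forall x : 'rV[R]_d, `|x ord0 i| <= K * gnorm G x.
  by move=> i; have [K] := coord_le_gnorm _ _ i Gp; exists K.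
exists (1 + \sum_i K i).
  by rewrite ltr_wpDr // sumr_ge0 // => i _; case: (HK i).
move=> x; have [x0|] := eqVneq (`|x|) 0.
  by rewrite x0 mulr_ge0 ?gnorm_ge0 // addr_ge0 ?sumr_ge0 // => i _; case: (HK i).
move=> /mx_norm_neq0[[j i]] /= xE; rewrite [leLHS]xE (ord1 j).
apply: (le_trans ((HK i).2 x)); rewrite ler_wpM2r ?gnorm_ge0 //.
rewrite (bigD1 i) //= addrCA lerDl addr_ge0 // sumr_ge0 // => k _.
by case: (HK k).
Qed.

Lemma is_norm0 d (N : 'rV[R]_d -> R) : is_norm N -> N 0 = 0.
Proof. by move=> [_ NZ _]; rewrite -(scale0r 0) NZ normr0 mul0r. Qed.

Lemma is_normN d (N : 'rV[R]_d -> R) x : is_norm N -> N (- x) = N x.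
Proof. by move=> [_ NZ _]; rewrite -scaleN1r NZ normrN1 mul1r. Qed.

Lemma is_norm_ge0 d (N : 'rV[R]_d -> R) x : is_norm N -> 0 <= N x.
Proof.
move=> Nn; have [ND _ _] := Nn; have := ND x (- x).
by rewrite subrr is_norm0 // is_normN //; lra.
Qed.

Lemma is_norm_sum d (N : 'rV[R]_d -> R) (I : Type) (s : seq I) F :
  is_norm N -> N (\sum_(i <- s) F i) <= \sum_(i <- s) N (F i).
Proof.
move=> Nn; have [ND _ _] := Nn; elim: s => [|i s IH].
  by rewrite !big_nil is_norm0.
by rewrite !big_cons (le_trans (ND _ _)) // lerD2l.
Qed.

Lemma is_norm_le_mx_norm d (N : 'rV[R]_d -> R) : is_norm N ->
  exists2 K : R, 0 < K & forall x : 'rV[R]_d, N x <= K * `|x|.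
Proof.
move=> Nn; have [_ NZ _] := Nn.
have S0 : 0 <= \sum_i N (delta_mx 0 i).
  by rewrite sumr_ge0 // => i _; exact: is_norm_ge0.
exists (1 + \sum_i N (delta_mx 0 i)); first by rewrite ltr_wpDr.
move=> x; rewrite mulrDl mul1r ler_wpDl // [in N x](row_sum_delta x) mulr_suml.
apply: (le_trans (is_norm_sum _ _ _ _ _ Nn)).
apply: ler_sum => i _; rewrite NZ mulrC ler_wpM2l ?is_norm_ge0 //.
rewrite [leRHS]mx_normrE.
exact: (le_bigmax _ (fun ij : 'I_1 * 'I_d => `|x ij.1 ij.2|) (ord0, i)).
Qed.

Lemma is_norm_continuous d (N : 'rV[R]_d -> R) : is_norm N -> continuous N.
Proof.
move=> Nn x; have [K K0 NK] := is_norm_le_mx_norm _ _ Nn.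
have [ND _ _] := Nn.
apply/(@cvgrPdist_le _ _ _ (nbhs x) (nbhs_filter x)) => e e0.
apply/nbhs_ballP; exists (e / K); first exact: divr_gt0.
move=> y; rewrite mx_norm_ball /ball_ /= => /ltW xy.
have h1 := ND (x - y) y; have h2 := ND (y - x) x.
rewrite !subrK in h1 h2.
have h3 : N (y - x) = N (x - y) by rewrite -opprB is_normN.
have h4 : N (x - y) <= e.
  by apply: (le_trans (NK _)); rewrite mulrC -ler_pdivlMr.
rewrite ler_norml; apply/andP; split; lra.
Qed.

Lemma is_norm_subr_continuous d (N : 'rV[R]_d -> R) (z : 'rV[R]_d) :
  is_norm N -> continuous (fun x : 'rV[R]_d => N (x - z)).
Proof.
move=> Nn x.
apply: (@continuous_comp _ _ _ (fun x : 'rV[R]_d => x - z) N x).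
  by apply: continuousB; [exact: cvg_id|exact: cst_continuous].
exact: is_norm_continuous.
Qed.

Lemma nbhs_gnorm d (G : 'M[R]_d) (x0 : 'rV[R]_d) (P : set 'rV[R]_d) :
  posdefmx G -> nbhs x0 P ->
  exists2 r : R, 0 < r & forall x, gnorm G (x - x0) <= r -> P x.
Proof.
move=> Gp /nbhs_ballP[e /= e0 eP].
have [K K0 GK] := mx_norm_le_gnorm _ _ Gp.
exists (e / K / 2); first by rewrite !divr_gt0.
move=> x xr; apply: eP; rewrite mx_norm_ball /ball_ /= distrC.
apply: (le_lt_trans (GK _)); rewrite mulrC -ltr_pdivlMr //.
by apply: (le_lt_trans xr); rewrite ltr_pdivrMr // ltr_pMr ?divr_gt0 // ltr1n.
Qed.

End quadratic_form.

Arguments bform {R d}.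
Arguments gnorm {R d}.

(** * Measurability on row vectors *)

Section measurability.
Context (R : realType).

Lemma measurable_coord d (i : 'I_d) :
  measurable_fun setT (fun x : 'rV[R]_d => x ord0 i).
Proof.
have -> : (fun x : 'rV[R]_d => x ord0 i) =
    (@tnth d (measurableTypeR R))^~ i \o @tuple_of_row R d.
  by apply/funext => x /=; rewrite tnth_mktuple.
apply: measurableT_comp; first exact: measurable_tnth.
exact: measurable_tuple_of_row.
Qed.

Definition box d (a : 'rV[R]_d) (e : R) : set 'rV[R]_d :=
  [set x | forall i, `|x ord0 i - a ord0 i| < e].

Lemma measurable_box d (a : 'rV[R]_d) e : measurable (box d a e).
Proof.
have -> : box d a e =
    \bigcap_i [set x : 'rV[R]_d | `|x ord0 i - a ord0 i| < e].
  by apply/seteqP; split => x /= H; [move=> i _; exact: H|move=> i; exact: H].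
apply: fin_bigcap_measurable => // i _.
have -> : [set x : 'rV[R]_d | `|x ord0 i - a ord0 i| < e] =
   (fun x : 'rV[R]_d => x ord0 i) @^-1` `]a ord0 i - e, a ord0 i + e[%classic.
  by apply/seteqP; split => x /=; rewrite in_itv /= ltr_distl.
rewrite -[X in measurable X]setTI; apply: measurable_coord => //.
Qed.

Lemma box_ball d (a x : 'rV[R]_d) e : box d a e x -> 0 < e -> `|x - a| < e.
Proof.
move=> H e0; have [->//|/mx_norm_neq0[[j i]] /= E] := eqVneq (`|x - a|) 0.
by rewrite [ltLHS]E (ord1 j) !mxE.
Qed.

(** The sigma-algebra is generated by the coordinates, not by the topology, so an open set is
    written as a countable union of boxes with rational centres and radii 1/(k+1). *)
Lemma open_measurable_rV d (U : set 'rV[R]_d) : open U -> measurable U.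
Proof.
move=> oU; pose F (p : 'rV[rat]_d * nat) : set 'rV[R]_d :=
  [set x | box d (map_mx ratr p.1) p.2.+1%:R^-1 x /\
           box d (map_mx ratr p.1) p.2.+1%:R^-1 `<=` U].
have -> : U = \bigcup_p F p.
  apply/seteqP; split => [x Ux|x [p _ [px pU]]]; last exact: pU.
  have /nbhs_ballP[e /= e0 eU] : nbhs x U by exact: open_nbhs_nbhs.
  have [k ke] : exists k : nat, k.+1%:R^-1 < e / 2.
    have [k] := ltr_add_invr (y := 0) (x := e / 2) (divr_gt0 e0 (ltr0Sn _ 1)).
    by rewrite add0r => H; exists k.
  have k0 : 0 < k.+1%:R^-1 :> R by rewrite invr_gt0.
  have /choice[q Hq] : forall i : 'I_d, exists q : rat,
      `|x ord0 i - ratr q| < k.+1%:R^-1.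
    move=> i; have [q] : exists q : rat,
        x ord0 i - k.+1%:R^-1 < ratr q < x ord0 i + k.+1%:R^-1.
      have /rat_in_itvoo[q] : x ord0 i - k.+1%:R^-1 < x ord0 i + k.+1%:R^-1.
        by rewrite ltrBlDr -addrA ltrDl addr_gt0.
      by rewrite in_itv /=; exists q.
    by move=> H; exists q; rewrite distrC ltr_distl.
  exists (\row_i q i, k) => //; split=> [i|y /= Hy].
    by rewrite !mxE /=.
  apply: eU; rewrite mx_norm_ball /ball_ /=.
  have -> : x - y = (x - map_mx ratr (\row_i q i)) - (y - map_mx ratr (\row_i q i)).
    by rewrite opprB addrA subrK.
  apply: (le_lt_trans (ler_normB _ _)).
  have h1 : `|x - map_mx ratr (\row_i q i)| < k.+1%:R^-1.
    by apply: box_ball => // i; rewrite !mxE.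
  have h2 := box_ball _ _ _ _ Hy k0.
  by rewrite (splitr e); apply: ltrD; [exact: lt_trans h1 ke|exact: lt_trans h2 ke].
apply: countable_bigcupT_measurable => // -[q k].
have [H|H] := pselect (box d (map_mx ratr q) k.+1%:R^-1 `<=` U).
  rewrite [F _](_ : _ = box d (map_mx ratr q) k.+1%:R^-1); first exact: measurable_box.
  by apply/seteqP; split => x /=; rewrite /F /=; [case|].
rewrite [F _](_ : _ = set0); first exact: measurable0.
by apply/seteqP; split => x //= -[].
Qed.

Lemma lower_semicontinuous_measurable d (f : 'rV[R]_d -> \bar R) :
  lower_semicontinuous f -> measurable_fun setT f.
Proof.
move=> /lower_semicontinuousP fo.
apply: (measurability _ (ErealGenOInfty.measurableE R)).
move=> /= _ [_ [r ->] <-]; apply: measurableI => //.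
by apply: open_measurable_rV; rewrite preimage_itvoy; exact: fo.
Qed.

Lemma continuous_measurable_rV d (f : 'rV[R]_d -> R) :
  continuous f -> measurable_fun setT f.
Proof.
move=> /continuousP cf; apply: (measurability _ (RGenOpens.measurableE R)).
move=> /= _ [_ [a [b ->] <-]]; apply: measurableI => //.
by apply: open_measurable_rV; apply: cf; exact: interval_open.
Qed.

End measurability.

(** * Schur complements, for induction on the dimension *)

Section schur_complement.
Context (R : realType) (n : nat) (G : 'M[R]_(1 + n)).
Hypothesis Gp : posdefmx G.
Let S : 'M[R]_n := drsubmx G.
Let u : 'rV[R]_n := ursubmx G.
Let w : 'rV[R]_n := u *m invmx S.
(** The Schur complement of [S] in [G], as the scalar left over after completing the square:
    [bform S w w] is u S^-1 u^T. *)
Let a : R := bform G (row_mx 1%:M 0) (row_mx 1%:M 0) - bform S w w.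

Let GE : G = block_mx (ulsubmx G) u u^T S.
Proof.
have [GT _] := Gp.
by rewrite -{1}(submxK G) /u trmx_ursub GT.
Qed.

Let bform_row0 z1 z2 : bform G (row_mx 0 z1) (row_mx 0 z2) = bform S z1 z2.
Proof.
by rewrite /bform GE mul_row_block tr_row_mx mul_row_col trmx0 !mul0mx mulmx0 !add0r.
Qed.

Lemma posdefmx_drsubmx : posdefmx S.
Proof.
have [GT Gpos] := Gp; split; first by rewrite /S trmx_drsub GT.
move=> v v0; rewrite -[X in 0 < X]/(bform S v v) -bform_row0; apply: Gpos.
by rewrite row_mx_eq0 negb_and v0 orbT.
Qed.

Let wS : w *m S = u.
Proof. by rewrite mulmxKV // posdefmx_unit //; exact: posdefmx_drsubmx. Qed.

Let bform_schur y z : bform G (row_mx y%:M z) (row_mx y%:M z) =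
  a * y ^+ 2 + bform S (z + y *: w) (z + y *: w).
Proof.
have [GT _] := Gp; have [ST _] := posdefmx_drsubmx.
have -> : row_mx y%:M z = y *: row_mx 1%:M 0 + row_mx 0 z.
  by rewrite scale_row_mx add_row_mx scaler0 add0r addr0 scale_scalar_mx mulr1.
rewrite !bformDl !bformDr !bformZl !bformZr bform_row0.
rewrite (bformC _ _ _ (row_mx 0 z) (row_mx 1%:M 0) GT) (bformC _ _ _ w z ST).
have -> : bform G (row_mx 1%:M 0) (row_mx 0 z) = bform S z w.
  rewrite [RHS]bformC // /bform wS GE mul_row_block tr_row_mx mul_row_col.
  by rewrite trmx0 mulmx0 !mul0mx !addr0 add0r mul1mx.
by rewrite /a; ring.
Qed.

Let a_gt0 : 0 < a.
Proof.
have [_ Gpos] := Gp; have := bform_schur 1 (- w).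
rewrite scale1r addNr {2}/bform !mul0mx mxE addr0 expr1n mulr1 => <-.
apply: Gpos; rewrite row_mx_eq0 negb_and; apply/orP; left.
by apply/eqP => /matrixP/(_ ord0 ord0)/eqP; rewrite !mxE eqxx oner_eq0.
Qed.

Let det_schur : \det G = a * \det S.
Proof.
have [ST _] := posdefmx_drsubmx.
(* Block elimination by a unitriangular factor, of determinant 1, makes [G] block triangular. *)
have E : block_mx 1%:M (- w) 0 1%:M *m G =
    block_mx (ulsubmx G - w *m u^T) 0 u^T S.
  rewrite [in LHS]GE mulmx_block !mul1mx !mul0mx !add0r mulNmx mulNmx wS.
  by rewrite subrr.
have := congr1 determinant E.
rewrite det_mulmx det_ublock !det1 !mul1r det_lblock => ->; congr (_ * _).
rewrite det_mx11 mxE [X in _ + X]mxE /a; congr (_ - _).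
  rewrite /bform [in RHS]GE mul_row_block tr_row_mx mul_row_col.
  by rewrite trmx0 mulmx0 addr0 !mul0mx addr0 mul1mx trmx1 mulmx1.
rewrite /bform wS -[LHS]/((w *m u^T) ord0 ord0).
have <- : (u *m w^T)^T = w *m u^T by rewrite trmx_mul trmxK.
by rewrite mxE.
Qed.

(** Completing the square in the first variable: a slice of an ellipsoid of [G] at fixed [y] lies in
    a translate of the ellipsoid of [S] at the same level. *)
Lemma schur_complement : exists (b : R) (v : 'rV[R]_n),
  [/\ 0 < b, \det G = b * \det S &
    forall y z, bform G (row_mx y%:M z) (row_mx y%:M z) =
      b * y ^+ 2 + bform S (z + y *: v) (z + y *: v)].
Proof. by exists a, w. Qed.

End schur_complement.

Lemma posdefmx_det_gt0 (R : realType) n (G : 'M[R]_n) :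
  posdefmx G -> 0 < \det G.
Proof.
elim: n G => [G _|n IH G Gp]; first by rewrite det_mx00.
have [b [v [b0 -> _]]] := @schur_complement R n G Gp.
by rewrite mulr_gt0 //; apply: IH; exact: (@posdefmx_drsubmx R n G Gp).
Qed.

(** * Product integrals and volumes *)

Section product_integral.
Context d (T : measurableType d) (R : realType).
Variable m : {sigma_finite_measure set T -> \bar R}.

Lemma ge0_integral_prod_measureS n (F : n.+1.-tuple T -> \bar R) :
  measurable_fun setT F -> (forall t, 0 <= F t)%E ->
  (\int[prod_measure m n.+1]_t F t =
   \int[m]_x \int[prod_measure m n]_t F (tcons (x, t)))%E.
Proof.
move=> mF F0.
have -> : (\int[prod_measure m n.+1]_t F t =
   \int[pushforward (m \x prod_measure m n) (@tcons _ T n)]_t F t)%E by [].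
rewrite ge0_integral_pushforward //; last exact: measurable_tcons.
rewrite preimage_setT fubini_tonelli1 //. 
- by apply: measurableT_comp => //; exact: measurable_tcons.
- by move=> x; exact: F0.
Qed.

Lemma integral_prod_measure (f : T -> R) n :
  measurable_fun setT f -> (forall x, 0 <= f x) ->
  (\int[prod_measure m n]_t (\prod_(i < n) f (tnth t i))%:E =
   (\int[m]_x (f x)%:E) ^+ n)%E.
Proof.
move=> mf f0; have mprod k : measurable_fun setT
    (fun t : k.-tuple T => (\prod_(i < k) f (tnth t i))%:E).
  apply/measurable_EFinP; apply: measurable_prod => i _.
  by apply: measurableT_comp => //; exact: measurable_tnth.
have prod0 k (t : k.-tuple T) : (0 <= (\prod_(i < k) f (tnth t i))%:E)%E.
  by rewrite lee_fin prodr_ge0.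
elim: n => [|n IH].
  rewrite expe0 [LHS]integral_dirac //; last exact: (mprod 0%N).
  by rewrite diracT mul1e big_ord0.
rewrite (ge0_integral_prod_measureS n _ (mprod n.+1) (prod0 n.+1)) expeS.
have prodS x (t : n.-tuple T) : (\prod_(i < n.+1) f (tnth (tcons (x, t)) i))%:E =
    ((f x)%:E * (\prod_(i < n) f (tnth t i))%:E)%E.
  rewrite big_ord_recl -EFinM.
  have -> : tnth (tcons (x, t)) ord0 = x by exact: tnth0.
  have -> : \prod_(i < n) f (tnth (tcons (x, t)) (lift ord0 i)) =
    \prod_(i < n) f (tnth t i) by apply: eq_bigr => i _; rewrite tnthS.
  by [].
transitivity (\int[m]_x ((f x)%:E * (\int[m]_y (f y)%:E) ^+ n))%E.
  apply: eq_integral => x _; under eq_integral do rewrite prodS.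
  rewrite ge0_integralZl_EFin ?IH //.
  exact: mprod.
rewrite ge0_integralZr //.
- exact/measurable_EFinP.
- by move=> x _; rewrite lee_fin.
- rewrite expe_ge0 // integral_ge0 // => x _; by rewrite lee_fin.
Qed.

End product_integral.

(** * Volumes of ellipsoids and boxes *)

Section ellipsoid_volume.
Context (R : realType).

Definition ellipsoid {d} (G : 'M[R]_d) (c : 'rV[R]_d) (s : R) : set 'rV[R]_d :=
  [set x | bform G (x - c) (x - c) <= s].

Lemma measurable_bform d (G : 'M[R]_d) c :
  measurable_fun setT (fun x : 'rV[R]_d => bform G (x - c) (x - c)).
Proof.
have -> : (fun x : 'rV[R]_d => bform G (x - c) (x - c)) = fun x : 'rV[R]_d =>
    \sum_j (\sum_i (x ord0 i - c ord0 i) * G i j) * (x ord0 j - c ord0 j).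
  apply/funext => x; rewrite /bform mxE; apply: eq_bigr => j _.
  by rewrite !mxE; congr (_ * _); apply: eq_bigr => i _; rewrite !mxE.
have mx i : measurable_fun setT (fun x : 'rV[R]_d => x ord0 i - c ord0 i).
  by apply: measurable_funB => //; exact: measurable_coord.
apply: measurable_sum => j; apply: measurable_funM => //.
by apply: measurable_sum => i; apply: measurable_funM.
Qed.

Lemma measurable_ellipsoid d (G : 'M[R]_d) c s : measurable (ellipsoid G c s).
Proof.
rewrite -[X in measurable X]setTI.
have -> : ellipsoid G c s = (fun x => bform G (x - c) (x - c)) @^-1` `]-oo, s].
  by apply/seteqP; split => x /=; rewrite in_itv.
exact: measurable_bform.
Qed.

Lemma row_of_tuple_tcons n (x : measurableTypeR R) (t : n.-tuple (measurableTypeR R)) :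
  row_of_tuple (tcons (x, t)) = row_mx x%:M (row_of_tuple t) :> 'rV[R]_(1 + n).
Proof.
apply/rowP => i; rewrite !mxE; case: splitP => j /= ij.
  rewrite (ord1 j) !mxE eqxx mulr1n /=.
  by have -> : i = ord0 by apply/val_inj; rewrite /= ij (ord1 j).
rewrite !mxE -(tnthS x t j); congr (tnth _ _).
by apply/val_inj; rewrite /= ij.
Qed.

(** The bound is the volume of a circumscribed parallelepiped. By induction, the first coordinate
    ranges over an interval of length 2 sqrt(s/b), and each section lies in a translated ellipsoid
    of the Schur block, whose bound does not depend on the section. *)
Lemma lebesgue_ellipsoid_le d (G : 'M[R]_d) (c : 'rV[R]_d) (s : R) :
  posdefmx G -> 0 <= s ->
  (lebesgue_rV R d (ellipsoid G c s) <=
   ((2 * Num.sqrt s) ^+ d / Num.sqrt (\det G))%:E)%E.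
Proof.
move=> Gp s0.
suff H : (prod_measure (@lebesgue_measure R) d
    (@row_of_tuple R d @^-1` ellipsoid G c s) <=
    ((2 * Num.sqrt s) ^+ d / Num.sqrt (\det G))%:E)%E by exact: H.
elim: d G c Gp => [G c Gp|n IH G c Gp].
  rewrite expr0 det_mx00 sqrtr1 divr1 /= diracE.
  by case: (_ \in _); rewrite lee_fin // ler01.
have [b [v [b0 detG GE]]] := @schur_complement R n G Gp.
have Sp := @posdefmx_drsubmx R n G Gp.
set S : 'M[R]_n := drsubmx (G : 'M[R]_(1 + n)) in detG GE Sp.
have dS := posdefmx_det_gt0 _ _ _ Sp.
set E := @row_of_tuple R n.+1 @^-1` ellipsoid G c s.
have mE : measurable E.
  rewrite -[X in measurable X]setTI; apply: measurable_row_of_tuple => //.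
  exact: measurable_ellipsoid.
set mu := @lebesgue_measure R; set nu := prod_measure _ _.
have -> : nu E = (\int[mu]_x (prod_measure mu n \o xsection (@tcons _ _ n @^-1` E)) x)%E.
  by [].
pose c0 := (c : 'rV[R]_(1 + n)) ord0 (lshift n ord0).
pose c' : 'rV[R]_n := rsubmx (c : 'rV[R]_(1 + n)).
have rowE x t : row_of_tuple (tcons (x, t)) - c =
    row_mx (x - c0)%:M (row_of_tuple t - c') :> 'rV[R]_(1 + n).
  have cE : c = row_mx c0%:M c' :> 'rV[R]_(1 + n).
    rewrite -[LHS](@hsubmxK _ 1 1 n); congr (row_mx _ _); apply/matrixP => i j.
    by rewrite !(ord1 i) !(ord1 j) !mxE eqxx mulr1n.
  transitivity ((row_mx x%:M (row_of_tuple t) : 'rV[R]_(1 + n)) - row_mx c0%:M c').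
    by rewrite -cE -row_of_tuple_tcons.
  rewrite opp_row_mx add_row_mx; congr (row_mx _ _); apply/matrixP => i j.
  by rewrite !(ord1 i) !(ord1 j) !mxE eqxx !mulr1n.
pose q := Num.sqrt (s / b).
pose K := (2 * Num.sqrt s) ^+ n / Num.sqrt (\det S).
have K0 : 0 <= K by rewrite divr_ge0 ?exprn_ge0 ?mulr_ge0 ?sqrtr_ge0.
(* Dropping the nonnegative term [b * (x - c0) ^+ 2] leaves the induction hypothesis at the same
   level [s]; beyond the interval that term alone exceeds [s] and the section is empty. *)
have sec x : (prod_measure mu n (xsection (@tcons _ _ n @^-1` E) x) <=
    (K * \1_(`[c0 - q, c0 + q]%classic) x)%:E)%E.
  have [xq|xq] := pselect (b * (x - c0) ^+ 2 <= s).
    have -> : \1_(`[c0 - q, c0 + q]%classic : set R) x = 1 :> R.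
      rewrite indicE mem_set //= in_itv /= -ler_distl.
      rewrite -(ler_pXn2r (ltn0Sn 1)) ?nnegrE ?sqrtr_ge0 //.
      rewrite real_normK ?num_real // sqr_sqrtr ?divr_ge0 ?(ltW b0) //.
      by rewrite ler_pdivlMr // mulrC.
    rewrite mulr1; apply: (le_trans _ (IH S (c' - (x - c0) *: v) Sp)).
    apply: le_measure; rewrite ?inE.
    - apply: measurable_xsection; rewrite -[X in measurable X]setTI.
      exact: measurable_tcons.
    - rewrite -[X in measurable X]setTI; apply: measurable_row_of_tuple => //.
      exact: measurable_ellipsoid.
    - move=> t; rewrite /xsection /= inE /E /ellipsoid /= rowE GE => H.
      have -> : row_of_tuple t - (c' - (x - c0) *: v) =
        row_of_tuple t - c' + (x - c0) *: v by rewrite opprB addrCA addrC.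
      apply: le_trans H; rewrite lerDr mulr_ge0 ?sqr_ge0 //; exact: ltW.
  rewrite [X in prod_measure _ _ X](_ : _ = set0) ?measure0.
    by rewrite lee_fin mulr_ge0 // indicE ler0n.
  rewrite -subset0 => t; rewrite /xsection /= inE /E /ellipsoid /= rowE GE => H.
  apply: xq; apply: le_trans H; rewrite lerDl; exact: bform_ge0.
apply: (@le_trans _ _ (\int[mu]_x (K * \1_(`[c0 - q, c0 + q]%classic) x)%:E)%E).
  apply: ge0_le_integral => //.
  - apply: measurable_fun_xsection; rewrite -[X in measurable X]setTI.
    exact: measurable_tcons.
  - by apply/measurable_EFinP; apply: measurable_funM => //; exact: measurable_indic.
  - by move=> x _; exact: sec.
under eq_integral do rewrite EFinM.
rewrite ge0_integralZl_EFin //; last first.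
  by apply/measurable_EFinP; exact: measurable_indic.
rewrite integral_indic // setIT.
have q0 : 0 <= q := sqrtr_ge0 _.
rewrite [X in (_ * X)%E](_ : _ = (2 * q)%:E); last first.
  apply: eq_trans (lebesgue_measure_itv `[c0 - q, c0 + q]) _.
  rewrite /= lte_fin; case: ltP => H; first by rewrite -EFinB; congr EFin; ring.
  by congr EFin; lra.
rewrite -EFinM lee_fin detG sqrtrM ?(ltW b0) // /q sqrtrM // sqrtrV ?(ltW b0) //.
rewrite /K exprS le_eqVlt; apply/orP; left; apply/eqP.
have sb : Num.sqrt b != 0 by rewrite gt_eqF // sqrtr_gt0.
have sS : Num.sqrt (\det S) != 0 by rewrite gt_eqF // sqrtr_gt0.
by field; rewrite sb sS.
Qed.

Lemma lebesgue_box_gt0 d (a : 'rV[R]_d) e : 0 < e ->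
  (0 < lebesgue_rV R d (box R d a e))%E.
Proof.
move=> e0.
suff H : (0 < prod_measure (@lebesgue_measure R) d
    (@row_of_tuple R d @^-1` box R d a e))%E by exact: H.
elim: d a => [a|n IH a].
  by rewrite /= diracE mem_set // => -[].
pose a0 := (a : 'rV[R]_(1 + n)) ord0 (lshift n ord0).
pose a' : 'rV[R]_n := rsubmx (a : 'rV[R]_(1 + n)).
set mu := @lebesgue_measure R; set nu := prod_measure _ _.
set E := @row_of_tuple R n.+1 @^-1` box R n.+1 a e.
have -> : nu E = (mu \x prod_measure mu n)%E (@tcons _ _ n @^-1` E) by [].
have -> : @tcons _ _ n @^-1` E =
    `]a0 - e, a0 + e[%classic `*` (@row_of_tuple R n @^-1` box R n a' e).
  apply/seteqP; split => -[x t]; rewrite /E /= in_itv /= -ltr_distl.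
    move=> H; split.
      have := H ord0; rewrite mxE /= /a0.
      by have -> : lshift n ord0 = ord0 :> 'I_(1 + n) by apply/val_inj.
    move=> i; have := H (lift ord0 i); rewrite !mxE tnthS.
    by have -> : rshift 1 i = lift ord0 i by apply/val_inj.
  move=> [xa ta] i; rewrite mxE; case: (unliftP ord0 i) => [j ->|->].
    have := ta j; rewrite tnthS !mxE.
    by have -> : rshift 1 j = lift ord0 j by apply/val_inj.
  move: xa; rewrite /a0.
  by have -> : lshift n ord0 = ord0 :> 'I_(1 + n) by apply/val_inj.
rewrite product_measure1E //; last first.
  rewrite -[X in measurable X]setTI; apply: measurable_row_of_tuple => //.
  exact: measurable_box.
apply: mule_gt0; last exact: (IH a').
apply: (@lt_le_trans _ _ (2 * e)%:E); first by rewrite lte_fin mulr_gt0.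
rewrite le_eqVlt; apply/orP; left; apply/eqP; symmetry.
apply: eq_trans (lebesgue_measure_itv `]a0 - e, a0 + e[) _.
rewrite /= lte_fin ifT; last by lra.
by rewrite -EFinB; congr EFin; ring.
Qed.

End ellipsoid_volume.

(** * The transformation near the minimum *)

Section transformation.
Context (R : realType) (d : nat) (h : \bar R -> \bar R).
Hypothesis dh : decreasing_transformation d h.

Lemma hreal_noninc (y z : R) : h y%:E \is a fin_num -> h z%:E \is a fin_num ->
  y <= z -> hreal h z <= hreal h y.
Proof.
by move=> hy hz yz; rewrite fine_le //; apply: dt_noninc; rewrite ?lee_fin //; exact: dh.
Qed.

Lemma derive1_hreal_le0 (m : R) : C1_at h m -> derive1 (hreal h) m <= 0.
Proof.
move=> C1; have := nbhs_singleton C1 => -[hm dm _].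
rewrite derive1E; apply: limr_le; first exact: dm.
move: C1 => /nbhs_ballP[e /= e0 He].
apply/nbhs_ballP; exists e => //= t; rewrite /ball /= sub0r normrN => te t0.
rewrite /GRing.scale /= mulr1.
have [ht _ _] : [/\ h (t + m)%:E \is a fin_num, derivable (hreal h) (t + m) 1 &
                         {for t + m, continuous (derive1 (hreal h))}].
  by apply: He; rewrite /ball /= opprD addrCA subrr addr0 normrN.
have [tp|tn] := ltP 0 t.
  rewrite mulr_ge0_le0 ?invr_ge0 ?(ltW tp) // subr_le0 hreal_noninc //; lra.
have {t0}tn : t < 0 by rewrite lt_neqAle t0.
by rewrite mulr_le0_ge0 ?invr_le0 ?(ltW tn) // subr_ge0 hreal_noninc //; lra.
Qed.

(** By continuity the derivative stays within [k / 2] of [- k] near [m], and the mean value theorem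
    gives both slopes. The strict decrease to the right of [m], together with [h >= 0], makes the
    value at [m] positive. *)
Lemma hreal_bilipschitz (m : R) : C1_at h m -> derive1 (hreal h) m != 0 ->
  let k := - derive1 (hreal h) m in
  [/\ 0 < k, 0 < hreal h m & exists e, [/\ 0 < e,
    forall y, `|y - m| <= e -> h y%:E \is a fin_num,
    forall y, `|y - m| <= e -> hreal h m / 2 <= hreal h y &
    forall y z, m - e <= y -> y <= z -> z <= m + e ->
      k / 2 * (z - y) <= hreal h y - hreal h z <= 2 * k * (z - y)]].
Proof.
move=> C1 hm0 k.
have k0 : 0 < k by rewrite oppr_gt0 lt_neqAle hm0 derive1_hreal_le0.
have [_ _ cm] := nbhs_singleton C1.
have /nbhs_ballP[e1 /= e10 He1] := C1.
have : \forall z \near m, `|derive1 (hreal h) m - derive1 (hreal h) z| < k / 2.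
  by move: cm => /cvgrPdist_lt; apply; rewrite divr_gt0.
move=> /nbhs_ballP[e2 /= e20 He2].
pose e3 := Num.min e1 e2 / 2.
have e12 : 0 < Num.min e1 e2 by rewrite lt_min e10.
have e30 : 0 < e3 by rewrite divr_gt0.
have e3e1 : e3 < e1.
  by rewrite /e3 ltr_pdivrMr // (le_lt_trans (_ : _ <= e1)) ?ge_min ?lexx // ltr_pMr // ltr1n.
have e3e2 : e3 < e2.
  by rewrite /e3 ltr_pdivrMr // (le_lt_trans (_ : _ <= e2)) ?ge_min ?lexx ?orbT // ltr_pMr // ltr1n.
have fin3 y : `|y - m| <= e3 -> h y%:E \is a fin_num.
  by move=> ye; have [] := He1 y; rewrite // /ball /= distrC (le_lt_trans ye).
have der y : `|y - m| <= e3 -> derivable (hreal h) y 1.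
  by move=> ye; have [] := He1 y; rewrite // /ball /= distrC (le_lt_trans ye).
have slope y z : m - e3 <= y -> y <= z -> z <= m + e3 ->
    k / 2 * (z - y) <= hreal h y - hreal h z <= 2 * k * (z - y).
  move=> my; rewrite le_eqVlt => /predU1P[->|yz] zm; first by rewrite !subrr !mulr0 lexx.
  have [||c cyz E] := @MVT R (hreal h) (derive1 (hreal h)) y z yz.
  - move=> x; rewrite in_itv /= => /andP[yx xz]; rewrite derive1E.
    by apply: DeriveDef => //; apply: der; rewrite ler_distl; apply/andP; split; lra.
  - apply: derivable_within_continuous => x; rewrite in_itv /= => /andP[yx xz].
    by apply: der; rewrite ler_distl; apply/andP; split; lra.
  move: cyz; rewrite in_itv /= => /andP[yc cz].
  have : `|derive1 (hreal h) m - derive1 (hreal h) c| < k / 2.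
    apply: He2; rewrite /ball /= distrC; apply: le_lt_trans e3e2.
    by rewrite ler_distl; apply/andP; split; lra.
  rewrite ltr_norml => /andP[c1 c2].
  have -> : hreal h y - hreal h z = - derive1 (hreal h) c * (z - y) by rewrite mulNr -E opprB.
  have zy : 0 <= z - y by lra.
  by rewrite !ler_wpM2r //; rewrite /k in c1 c2 *; lra.
have H0 : 0 < hreal h m.
  have /andP[+ _] := slope m (m + e3) ltac:(lra) ltac:(lra) ltac:(lra).
  have : 0 <= hreal h (m + e3) by rewrite fine_ge0 // (dt_ge0 dh).
  have -> : m + e3 - m = e3 by ring.
  have : 0 < k / 2 * e3 by rewrite mulr_gt0 // divr_gt0.
  by lra.
(* The second term of the minimum limits the drop of [h] over the interval to half its value at
   [m]. *)
split => //; pose e := Num.min e3 (hreal h m / (4 * k)).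
have e3e : e <= e3 by rewrite ge_min lexx.
have e0 : 0 < e by rewrite lt_min e30 divr_gt0 // mulr_gt0.
have eH : 2 * k * e <= hreal h m / 2.
  rewrite (le_trans (_ : _ <= 2 * k * (hreal h m / (4 * k)))) //.
    by rewrite ler_wpM2l ?mulr_ge0 ?(ltW k0) // ge_min lexx orbT.
  by rewrite le_eqVlt; apply/orP; left; apply/eqP; field; rewrite gt_eqF.
exists e; split => //.
- by move=> y ye; apply: fin3; exact: le_trans e3e.
- move=> y; rewrite ler_distl => /andP[y1 y2].
  have [my|ym] := leP m y.
    have /andP[_] := slope m y ltac:(lra) my ltac:(lra).
    have : 2 * k * (y - m) <= 2 * k * e.
      by rewrite ler_wpM2l ?mulr_ge0 ?(ltW k0) //; lra.
    by lra.
  have : hreal h m <= hreal h y.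
    by apply: hreal_noninc; rewrite ?(ltW ym) // fin3 ?subrr ?normr0 ?(ltW e30) //;
      rewrite ler_distl; apply/andP; split; lra.
  by lra.
- by move=> y z y1 yz z1; apply: slope; lra.
Qed.

(** By monotonicity, the set where [h] exceeds a level is a ray, closed or open according as it
    contains its supremum. *)
Lemma measurable_transformation : measurable_fun setT h.
Proof.
apply: (measurability _ (ErealGenOInfty.measurableE R)) => /= _ [_ [r ->] <-].
apply: measurableI => //; rewrite preimage_itvoy.
set D := [set x | _].
have Dd x y : (x <= y)%E -> D y -> D x.
  by move=> xy; rewrite /D /= => /lt_le_trans; apply; exact: (dt_noninc dh).
have [Dc|Dc] := pselect (D (ereal_sup D)).
  rewrite [D](_ : _ = `]-oo, ereal_sup D]%classic); first exact: emeasurable_itv.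
  apply/seteqP; split => x /=; rewrite in_itv /=; first exact: ereal_sup_ubound.
  by move=> xD; exact: Dd Dc.
rewrite [D](_ : _ = `]-oo, ereal_sup D[%classic); first exact: emeasurable_itv.
apply/seteqP; split => x /=; rewrite in_itv /=.
  move=> Dx; rewrite lt_neqAle ereal_sup_ubound // andbT.
  by apply/eqP => E; apply: Dc; rewrite -E.
by move=> /ereal_sup_gt[y Dy xy]; exact: Dd (ltW xy) Dy.
Qed.

End transformation.

(** * Convex gluing *)

Section convex_gluing.
Context (R : realType) (d : nat).
Implicit Types (f g : 'rV[R]_d -> \bar R) (x y : 'rV[R]_d).

Lemma is_norm_convex (N : 'rV[R]_d -> R) (c x y : 'rV[R]_d) (t : R) :
  is_norm N -> 0 <= t <= 1 ->
  N (t *: x + (1 - t) *: y - c) <= t * N (x - c) + (1 - t) * N (y - c).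
Proof.
move=> [ND NZ _] /andP[t0 t1].
have -> : t *: x + (1 - t) *: y - c = t *: (x - c) + (1 - t) *: (y - c).
  by apply/rowP => i; rewrite !mxE; ring.
by rewrite (le_trans (ND _ _)) // !NZ !ger0_norm // subr_ge0.
Qed.

Section glue.
Variables (rho : 'rV[R]_d -> R) (c : 'rV[R]_d) (r : R).
Hypotheses (rho_norm : is_norm rho) (r0 : 0 < r).
Variables (f g : 'rV[R]_d -> \bar R).
Hypothesis gNy : forall x, g x != -oo%E.
Hypothesis gconv : econvex g.
Hypothesis fg_out : forall x, r <= rho (x - c) -> f x = g x.
Hypothesis fg_le : forall x, (f x <= g x)%E.
Hypothesis f_fin : forall x, rho (x - c) <= 2 * r -> f x \is a fin_num.
Hypothesis f_loc : forall x y t, rho (x - c) <= 2 * r -> rho (y - c) <= 2 * r ->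
  0 <= t <= 1 -> (f (t *: x + (1 - t) *: y) <= t%:E * f x + (1 - t)%:E * f y)%E.

(* On a segment leaving the large ball, the small sphere is crossed at [s1] and
   the large one at [s2 > s1]: the function is convex on [0, s2] and on [s1, 1],
   and these intervals overlap. *)
Let glue_exit x y (s : R) : rho (x - c) < r -> 2 * r < rho (y - c) ->
  0 < s -> s < 1 -> (f ((1 - s) *: x + s *: y) <= (1 - s)%:E * f x + s%:E * f y)%E.
Proof.
move=> xr yr s0 s1; have [ND NZ _] := rho_norm.
have r0' : 0 < r := r0.
have xfin : f x \is a fin_num by apply: f_fin; lra.
have fyg : f y = g y by apply: fg_out; lra.
have [gy|gy] := eqVneq (g y) +oo%E.
  have : ((1 - s)%:E * f x)%E \is a fin_num by rewrite fin_numM.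
  rewrite fin_numE => /andP[xNy _].
  by rewrite fyg gy gt0_muley ?lte_fin // addey ?leey.
have yfin : f y \is a fin_num by rewrite fyg fin_numE gNy gy.
pose P (u : R) := (1 - u) *: x + u *: y.
have P0 : P 0 = x by rewrite /P subr0 scale1r scale0r addr0.
have P1 : P 1 = y by rewrite /P subrr scale1r scale0r add0r.
have Pcont : continuous (fun u => rho (P u - c)).
  move=> u; apply/cvgrPdist_le => e e0.
  have D0 : 0 < 1 + rho (y - x) by rewrite ltr_pwDl // is_norm_ge0.
  have lip a b : rho (P a - c) <= rho (P b - c) + `|a - b| * rho (y - x).
    rewrite -NZ; apply: le_trans (ND _ _); rewrite le_eqVlt; apply/orP; left.
    by apply/eqP; congr rho; apply/rowP => i; rewrite !mxE; ring.
  near=> v; have uv : `|u - v| * (1 + rho (y - x)) <= e.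
    rewrite -ler_pdivlMr //; near: v.
    by move: (@cvg_id _ (nbhs u)) => /cvgrPdist_le; apply; exact: divr_gt0.
  have := lip u v; have := lip v u; rewrite distrC => h1 h2.
  have := normr_ge0 (u - v); rewrite ler_norml => h3.
  by apply/andP; split; lra.
have Pc u v : 0 < v -> 0 <= u <= v -> P u = (1 - u / v) *: P 0 + (1 - (1 - u / v)) *: P v.
  move=> v0 _; apply/rowP => i; rewrite !mxE; field; exact: lt0r_neq0.
have Pc2 u v : u < 1 -> u <= v <= 1 ->
    P v = ((1 - v) / (1 - u)) *: P u + (1 - (1 - v) / (1 - u)) *: P 1.
  move=> u1 _; have u1' : 1 - u != 0 by rewrite subr_eq0 gt_eqF.
  by apply/rowP => i; rewrite !mxE; field.
have [s2 s2I s2E] : exists2 s2, s2 \in `[0, 1] & rho (P s2 - c) = 2 * r.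
  apply: IVT; rewrite ?(ltW s20) ?ler01 //; first exact: continuous_subspaceT.
  by rewrite P0 P1 ge_min le_max (ltW yr) orbT andbT; apply/orP; left; lra.
move: s2I; rewrite in_itv /= => /andP[s20 s21].
have [s3 s3I s3E] : exists2 s3, s3 \in `[0, s2] & rho (P s3 - c) = r.
  apply: IVT; rewrite ?(ltW s20) ?ler01 //; first exact: continuous_subspaceT.
  by rewrite P0 s2E ge_min le_max (ltW xr) /=; apply/orP; right; lra.
move: s3I; rewrite in_itv /= => /andP[s30 s32].
have {}s32 : s3 < s2.
  by rewrite lt_neqAle s32 andbT; apply/eqP => E; move: s3E; rewrite E s2E; lra.
have {}s20 : 0 < s2 by lra.
have {}s21 : s2 < 1.
  by rewrite lt_neqAle s21 andbT; apply/eqP => E; move: s2E; rewrite E P1; lra.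
have {}s30 : 0 < s3.
  rewrite lt_neqAle s30 andbT; apply/eqP => E; move: s3E; rewrite -E P0; lra.
(* [P s3] lies between [P 0] and [P u]. As [P 0] is inside the small ball and [P s3] on its sphere,
   convexity of the norm forbids [P u] to be inside. *)
have out u : s3 <= u -> u <= 1 -> r <= rho (P u - c).
  move=> s3u u1; have u0 : 0 < u by lra.
  have a01 : 0 <= 1 - s3 / u <= 1.
    by rewrite subr_ge0 ler_pdivrMr // mul1r s3u gerBl divr_ge0 // ltW.
  have := is_norm_convex rho c (P 0) (P u) (1 - s3 / u) rho_norm a01.
  rewrite -Pc ?s3E ?s3u ?(ltW s30) // P0 => H.
  have a1 : 0 < s3 / u by rewrite divr_gt0.
  have : s3 / u * r <= s3 / u * rho (P u - c).
    by move: H xr a01 => /=; nra.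
  by rewrite ler_pM2l.
have fin2 : f (P s2) \is a fin_num by apply: f_fin; rewrite s2E.
have fin3 : f (P s3) \is a fin_num by apply: f_fin; rewrite s3E; lra.
have i1 : fine (f (P s3)) <= (1 - s3 / s2) * fine (f x) + (s3 / s2) * fine (f (P s2)).
  have : 0 <= 1 - s3 / s2 <= 1.
    by rewrite subr_ge0 ler_pdivrMr // mul1r (ltW s32) gerBl divr_ge0 // ltW.
  move=> /f_loc => /(_ x (P s2)); rewrite -{2}P0 -Pc ?(ltW s32) ?(ltW s30) // s2E lexx.
  move=> /(_ ltac:(lra) isT).
  rewrite -(fineK fin3) -(fineK fin2) -(fineK xfin) -!EFinM -EFinD lee_fin subKr.
  by [].
have i2 : (1 - s3) * fine (f (P s2)) <=
    (1 - s2) * fine (f (P s3)) + (s2 - s3) * fine (f y).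
  have s31 : 0 < 1 - s3 by lra.
  have : 0 <= (1 - s2) / (1 - s3) <= 1.
    by rewrite ler_pdivrMr // divr_ge0 ?subr_ge0 ?(ltW s21) ?(ltW s31) //=; lra.
  move=> /(gconv (P s3) y); rewrite -{1}P1 -Pc2 ?(ltW s32) ?(ltW s21) //; last by lra.
  rewrite -!fg_out ?s3E ?s2E //; [|lra|lra].
  rewrite -(fineK fin3) -(fineK fin2) -(fineK yfin) -!EFinM -EFinD lee_fin.
  rewrite -(ler_pM2l s31) => /le_trans; apply; rewrite le_eqVlt; apply/orP; left.
  by apply/eqP; field; exact: lt0r_neq0.
(* Eliminating the value at [s3] between [i1] and [i2] leaves the chord inequality at [s2], up to
   the positive factor [s2 - s3]. A point on either side of [s2] is then compared with [s2] and one
   end. *)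
have i3 : fine (f (P s2)) <= (1 - s2) * fine (f x) + s2 * fine (f y).
  have i1' : s2 * fine (f (P s3)) <= (s2 - s3) * fine (f x) + s3 * fine (f (P s2)).
    move: i1; rewrite -(ler_pM2l s20) => /le_trans; apply; rewrite le_eqVlt.
    by apply/orP; left; apply/eqP; field; exact: lt0r_neq0.
  have h1 := ler_wpM2l (ltac:(lra) : 0 <= 1 - s2) i1'.
  have h2 := ler_wpM2l (ltW s20) i2.
  rewrite -(@ler_pM2l _ (s2 - s3)); last by lra.
  by lra.
rewrite -/(P s) -(fineK xfin) -(fineK yfin) -!EFinM -EFinD.
have [ss2|s2s] := leP s s2.
  have a01 : 0 <= 1 - s / s2 <= 1.
    by rewrite subr_ge0 ler_pdivrMr // mul1r ss2 gerBl divr_ge0 // ltW.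
  have hx : rho (x - c) <= 2 * r by lra.
  have hs2 : rho (P s2 - c) <= 2 * r by rewrite s2E.
  have := f_loc x (P s2) _ hx hs2 a01.
  rewrite -{1}P0 -Pc ?ss2 ?(ltW s0) // => /le_trans; apply.
  rewrite -(fineK fin2) -(fineK xfin) -!EFinM -EFinD lee_fin subKr /=.
  have : 0 <= s / s2 by rewrite divr_ge0 // ltW.
  move=> /ler_wpM2l/(_ _ _ i3) H.
  apply: (@le_trans _ _ ((1 - s / s2) * fine (f x) +
    s / s2 * ((1 - s2) * fine (f x) + s2 * fine (f y)))); first by rewrite lerD2l.
  rewrite le_eqVlt; apply/orP; left; apply/eqP; field; exact: lt0r_neq0.
have s2' : 0 < 1 - s2 by lra.
have a01 : 0 <= (1 - s) / (1 - s2) <= 1.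
  by rewrite ler_pdivrMr // divr_ge0 ?subr_ge0 ?(ltW s1) ?(ltW s2') //=; lra.
have := gconv (P s2) y _ a01.
rewrite -{1}P1 -Pc2 ?(ltW s2s) ?(ltW s1) //.
rewrite -!fg_out ?s2E ?out //; [|lra..].
move=> /le_trans; apply.
rewrite -(fineK fin2) -(fineK yfin) -!EFinM -EFinD lee_fin /=.
have : 0 <= (1 - s) / (1 - s2) by case/andP: a01.
move=> /ler_wpM2l/(_ _ _ i3) H.
apply: (@le_trans _ _ ((1 - s) / (1 - s2) * ((1 - s2) * fine (f x) + s2 * fine (f y)) +
   (1 - (1 - s) / (1 - s2)) * fine (f y))); first by rewrite lerD2r.
rewrite le_eqVlt; apply/orP; left; apply/eqP; field; exact: lt0r_neq0.
Unshelve. all: by end_near. Qed.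

(** If both ends lie outside the small ball, [f = g] there and [f <= g] in between; if both lie in
    the large ball, [f_loc] applies. Otherwise one end is inside the small ball and the other beyond
    the large one. *)
Lemma econvex_glue : econvex f.
Proof.
move=> x y t /andP[t0 t1]; have r0' : 0 < r := r0.
have [->|tn0] := eqVneq t 0.
  by rewrite scale0r subr0 scale1r add0r mul0e add0e mul1e.
have [->|tn1] := eqVneq t 1.
  by rewrite subrr scale0r scale1r addr0 mul0e adde0 mul1e.
have {}t0 : 0 < t by rewrite lt_neqAle eq_sym tn0.
have {}t1 : t < 1 by rewrite lt_neqAle tn1.
have t01 : 0 <= t <= 1 by rewrite !ltW.
have [xr|xr] := ltP (rho (x - c)) r.
  have [yr|yr] := leP (rho (y - c)) (2 * r); first by apply: f_loc => //; lra.
  by have := glue_exit x y (1 - t) xr yr; rewrite !subKr; apply; lra.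
have [yr|yr] := ltP (rho (y - c)) r.
  have [xr2|xr2] := leP (rho (x - c)) (2 * r); first by apply: f_loc => //; lra.
  by rewrite addrC addeC; apply: glue_exit.
by rewrite (fg_out _ xr) (fg_out _ yr) (le_trans (fg_le _)) // gconv.
Qed.

End glue.

Lemma econvex_max f g : econvex f -> econvex g ->
  econvex (fun x => Order.max (f x) (g x)).
Proof.
move=> cf cg x y t t01; have /andP[t0 t1] := t01.
have t1' : 0 <= 1 - t by lra.
by rewrite ge_max; apply/andP; split; [apply: (le_trans (cf _ _ _ t01))
 |apply: (le_trans (cg _ _ _ t01))]; apply: leeD; apply: lee_wpmul2l;
  rewrite ?lee_fin // le_max lexx ?orbT.
Qed.

Lemma lower_semicontinuous_max f g : lower_semicontinuous f ->
  lower_semicontinuous g -> lower_semicontinuous (fun x => Order.max (f x) (g x)).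
Proof.
move=> lf lg x a; rewrite lt_max => /orP[/lf|/lg] [V xV Va]; exists V => // y /Va ay;
  by rewrite lt_max ay ?orbT.
Qed.

Lemma continuous_lower_semicontinuous (c : 'rV[R]_d -> R) :
  continuous c -> lower_semicontinuous (fun x => (c x)%:E).
Proof.
move=> cc x a ax; exists [set y | a < c y] => //.
have := cc x => /cvgrPdist_lt/(_ (c x - a)); rewrite subr_gt0 => /(_ ax).
by apply: filterS => y /=; rewrite ltr_distlC => /andP[+ _]; lra.
Qed.

Lemma lower_semicontinuous_subr f (c : 'rV[R]_d -> R) : lower_semicontinuous f ->
  continuous c -> lower_semicontinuous (fun x => (f x - (c x)%:E)%E).
Proof.
move=> lf cc x a; cbv beta; rewrite lteBrDr // -EFinD => ax.
(* A level [b] strictly in between leaves room for the variation of [c]. *)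
have [b ab bx] : exists2 b : R, a + c x < b & (b%:E < f x)%E.
  move: ax; case: (f x) => [u|_|//]; last by exists (a + c x + 1); rewrite ?ltry // ltrDl.
  rewrite lte_fin => au; exists ((a + c x + u) / 2); rewrite ?lte_fin; lra.
have [V xV Vb] := lf _ _ bx.
have : nbhs x [set y | c y < b - a].
  have := cc x; move/cvgrPdist_lt => /(_ (b - a - c x) ltac:(lra)).
  by apply: filterS => y /=; rewrite ltr_distlC => /andP[_]; lra.
move=> xW; exists (V `&` [set y | c y < b - a]); first exact: filterI.
move=> y [/Vb by_]; rewrite /mkset => cy; cbv beta; rewrite lteBrDr // -EFinD.
by apply: le_lt_trans by_; rewrite lee_fin; lra.
Qed.

End convex_gluing.

(** * Deformation of the convex function *)

Section bump.
Context (R : realType).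
Implicit Types r s u v w : R.

(** Subtracted from u^2/2, it leaves the line r u - r^2/2 on [0, r] and u^2/2 beyond: its curvature
    is exactly what the quadratic part can pay for. *)
Definition bump r u : R := Num.max (r - u) 0 ^+ 2 / 2.

Lemma bump_ge0 r u : 0 <= bump r u.
Proof. by rewrite divr_ge0 // sqr_ge0. Qed.

Lemma bump_out r u : r <= u -> bump r u = 0.
Proof.
move=> ru; rewrite /bump (_ : Num.max _ _ = 0) ?expr0n ?mul0r //.
by apply/max_idPr; lra.
Qed.

Lemma bump_le r u : 0 <= r -> 0 <= u -> bump r u <= r ^+ 2 / 2.
Proof.
move=> r0 u0; rewrite ler_pM2r ?invr_gt0 // ler_sqr ?nnegrE ?le_max ?lexx ?orbT //.
by rewrite ge_max; apply/andP; split; lra.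
Qed.

Lemma bump_ge r u : 0 <= r -> u <= r / 2 -> r ^+ 2 / 8 <= bump r u.
Proof.
move=> r0 ur; have -> : r ^+ 2 / 8 = (r / 2) ^+ 2 / 2 by field.
rewrite ler_pM2r ?invr_gt0 // ler_sqr ?nnegrE ?le_max ?lexx ?orbT //; last lra.
by apply/orP; left; lra.
Qed.

(* [u^2/2 - bump r u] is convex as the supremum of these lines: it is touched by
   the line at [s] if [s > r], and on [0, r] if [s = r]. *)
Lemma sqr_bump_ge r s u : r <= s -> 0 <= u -> s * u - s ^+ 2 / 2 <= u ^+ 2 / 2 - bump r u.
Proof.
move=> rs u0; have [ru|ur] := leP r u.
  by rewrite bump_out //; have := sqr_ge0 (u - s); nra.
have -> : bump r u = (r - u) ^+ 2 / 2.
  by rewrite /bump (_ : Num.max _ _ = r - u) //; apply/max_idPl; lra.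
have : 0 <= (s - r) * ((s + r) / 2 - u) by rewrite mulr_ge0 //; lra.
by nra.
Qed.

(** Only an upper bound on [w] is assumed, as [w] will be the norm of a convex combination. The
    supporting line at [w] has slope [s > 0], which lets this bound through. *)
Lemma sqr_bump_convex r u v w t : 0 < r -> 0 <= u -> 0 <= v -> 0 <= w ->
  0 <= t <= 1 -> w <= t * u + (1 - t) * v ->
  w ^+ 2 / 2 - bump r w <=
    t * (u ^+ 2 / 2 - bump r u) + (1 - t) * (v ^+ 2 / 2 - bump r v).
Proof.
move=> r0 u0 v0 w0 /andP[t0 t1] wuv.
pose s := Num.max r w.
have rs : r <= s by rewrite le_max lexx.
have E : w ^+ 2 / 2 - bump r w = s * w - s ^+ 2 / 2.
  rewrite /s; have [rw|wr] := leP r w.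
    by rewrite bump_out //; lra.
  rewrite (_ : bump r w = (r - w) ^+ 2 / 2); last first.
    by rewrite /bump (_ : Num.max _ _ = r - w) //; apply/max_idPl; lra.
  by lra.
have t1' : 0 <= 1 - t by lra.
have h1 := ler_wpM2l t0 (sqr_bump_ge r s u rs u0).
have h2 := ler_wpM2l t1' (sqr_bump_ge r s v rs v0).
have h3 : s * w <= s * (t * u + (1 - t) * v).
  by rewrite ler_wpM2l // (le_trans (ltW r0)).
by rewrite E; lra.
Qed.

Lemma bump_continuous r : continuous (bump r).
Proof.
have -> : bump r = fun u => ((r - u + `|r - u|) / 2) ^+ 2 / 2.
  apply/funext => u; rewrite /bump; congr (_ ^+ _ / _).
  by case: (leP (r - u) 0) => H; [rewrite ler0_norm|rewrite gtr0_norm]; rewrite //; lra.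
move=> u; apply: cvgMr_tmp.
apply: (@continuous_comp _ _ _ (fun v => (r - v + `|r - v|) / 2) (fun v => v ^+ 2)).
  have h : r - v @[v --> u] --> r - u by apply: cvgB; [exact: cvg_cst|exact: cvg_id].
  by apply: cvgMr_tmp; apply: cvgD => //; exact: cvg_norm.
exact: exprn_continuous.
Qed.

End bump.
Arguments bump {R}.

Section deformation.
Context (R : realType) (d : nat).
Variables (g : 'rV[R]_d -> \bar R) (x0 : 'rV[R]_d) (G : 'M[R]_d).
Variables (q : 'rV[R]_d -> \bar R) (r : R).
Hypotheses (ga : admissible g) (gmin : unique_min g x0).
Hypotheses (Gp : posdefmx G) (r0 : 0 < r).
Hypothesis qconv : econvex q.
Hypothesis gfin : forall x, gnorm G (x - x0) <= 2 * r -> g x \is a fin_num.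
Hypothesis gq : forall x, gnorm G (x - x0) <= 2 * r ->
  g x = ((2^-1 * bform G (x - x0) (x - x0))%:E + q x)%E.

Let rho x := gnorm G (x - x0).
Let m := fine (g x0).

Definition lowered (th : R) (x : 'rV[R]_d) : \bar R :=
  (g x - (th * bump r (gnorm G (x - x0)))%:E)%E.

Let rho_conv x y t : 0 <= t <= 1 ->
  rho (t *: x + (1 - t) *: y) <= t * rho x + (1 - t) * rho y.
Proof. by apply: is_norm_convex; exact: gnorm_is_norm. Qed.

Let rho_ball x y t : rho x <= 2 * r -> rho y <= 2 * r -> 0 <= t <= 1 ->
  rho (t *: x + (1 - t) *: y) <= 2 * r.
Proof.
move=> hx hy t01; apply: (le_trans (rho_conv x y t t01)).
move/andP: t01 => [t0 t1]; have t1' : 0 <= 1 - t by lra.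
have := ler_wpM2l t0 hx; have := ler_wpM2l t1' hy; lra.
Qed.

Let q_fin x : rho x <= 2 * r -> q x \is a fin_num.
Proof.
by move=> hx; have := gfin x hx; rewrite gq // fin_numD => /andP[].
Qed.

Let gE x : rho x <= 2 * r -> g x = (rho x ^+ 2 / 2 + fine (q x))%:E.
Proof.
by move=> hx; rewrite gq // EFinD fineK ?q_fin // sqr_gnorm // [in RHS]mulrC.
Qed.

Let q_conv_fine x y t : rho x <= 2 * r -> rho y <= 2 * r -> 0 <= t <= 1 ->
  fine (q (t *: x + (1 - t) *: y)) <= t * fine (q x) + (1 - t) * fine (q y).
Proof.
move=> hx hy t01; have := qconv x y t t01.
rewrite -(fineK (q_fin _ (rho_ball _ _ _ hx hy t01))) -(fineK (q_fin _ hx)).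
by rewrite -(fineK (q_fin _ hy)) -!EFinM -EFinD lee_fin.
Qed.

Let loweredE th x : rho x <= 2 * r -> lowered th x =
  (rho x ^+ 2 / 2 + fine (q x) - th * bump r (rho x))%:E.
Proof. by move=> hx; rewrite /lowered gE. Qed.

(** In the ball the function is q + (1 - th) rho^2/2 + th (rho^2/2 - bump), a sum of convex terms as
    [th <= 1]. Beyond radius [r] it is [g], and the two are glued. *)
Lemma lowered_convex th : 0 <= th <= 1 -> econvex (lowered th).
Proof.
move=> /andP[th0 th1]; have [[gNy _ gconv _] _] := ga.
apply: (@econvex_glue R d (gnorm G) x0 r (gnorm_is_norm _ _ _ Gp) r0 _ g) => //.
- by move=> x xr; rewrite /lowered bump_out // mulr0 sube0.
- move=> x; rewrite /lowered leeBlDr // leeDl // lee_fin mulr_ge0 ?bump_ge0 //.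
- by move=> x hx; rewrite /lowered fin_numB gfin.
move=> x y t hx hy t01; 
rewrite (loweredE _ _ hx) (loweredE _ _ hy) (loweredE _ _ (rho_ball _ _ _ hx hy t01)).
rewrite -!EFinM -EFinD lee_fin.
have := q_conv_fine x y t hx hy t01.
have rz := rho_conv x y t t01.
have h1 := sqr_bump_convex _ r _ _ _ _ r0 (gnorm_ge0 _ _ G (x - x0))
  (gnorm_ge0 _ _ G (y - x0)) (gnorm_ge0 _ _ G (t *: x + (1 - t) *: y - x0)) t01 rz.
rewrite -!/(rho _) in h1 *.
have h2 : rho (t *: x + (1 - t) *: y) ^+ 2 / 2 <=
    t * (rho x ^+ 2 / 2) + (1 - t) * (rho y ^+ 2 / 2).
  move/andP: t01 => [t0 t1].
  have h3 : rho (t *: x + (1 - t) *: y) ^+ 2 <= (t * rho x + (1 - t) * rho y) ^+ 2.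
    by rewrite ler_sqr ?nnegrE ?gnorm_ge0 // addr_ge0 // mulr_ge0 ?gnorm_ge0 //; lra.
  have h4 : 0 <= t * (1 - t) * (rho x - rho y) ^+ 2.
    by rewrite mulr_ge0 ?sqr_ge0 // mulr_ge0 //; lra.
  by nra.
have th1' : 0 <= 1 - th by lra.
have := ler_wpM2l th0 h1; have := ler_wpM2l th1' h2.
by move=> H1 H2 H3; lra.
Qed.

Lemma lowered_lsc th : lower_semicontinuous (lowered th).
Proof.
have [[_ _ _ glsc] _] := ga.
have cn : continuous (fun x : 'rV[R]_d => gnorm G (x - x0)).
  by apply: is_norm_subr_continuous; exact: gnorm_is_norm.
have cb : continuous (bump r \o (fun x : 'rV[R]_d => gnorm G (x - x0))).
  by move=> x; apply: continuous_comp; [exact: cn|exact: bump_continuous].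
apply: lower_semicontinuous_subr => // x.
exact: cvgMl_tmp (cb x).
Qed.

Definition deform (th : R) (psi : 'rV[R]_d -> R) (x : 'rV[R]_d) : \bar R :=
  Order.max (lowered th x) (psi x)%:E.

Lemma deform_admissible th psi : 0 <= th <= 1 -> continuous psi ->
  econvex (fun x => (psi x)%:E) -> admissible (deform th psi).
Proof.
move=> th01 cpsi psiconv; have [[gNy gdom gconv glsc] gdim] := ga.
have domE : edom (deform th psi) = edom g.
  by apply/seteqP; split => x; rewrite /edom /= /deform gt_max ltry andbT /lowered lteBlDr.
suff cpc : closed_proper_convex (deform th psi) by split=> //; rewrite domE.
split.
- move=> x; rewrite -ltNye lt_max; apply/orP; right; exact: ltNyr.
- by rewrite domE.
- by apply: econvex_max => //; exact: lowered_convex.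
- apply: lower_semicontinuous_max; first exact: lowered_lsc.
  exact: continuous_lower_semicontinuous.
Qed.

(* Strong convexity between [x0], where [g] is minimal, and [x], at the midpoint. *)
Lemma quadratic_growth x : gnorm G (x - x0) <= 2 * r ->
  ((m + gnorm G (x - x0) ^+ 2 / 4)%:E <= g x)%E.
Proof.
move=> hx; have h0 : rho x0 <= 2 * r.
  by rewrite /rho subrr is_norm0 ?mulr_ge0 ?(ltW r0) //; exact: gnorm_is_norm.
have t01 : 0 <= (2^-1 : R) <= 1 by rewrite invr_ge0 ler0n invf_le1 ?ler1n.
have hz := rho_ball _ _ _ hx h0 t01.
have qz := q_conv_fine _ _ _ hx h0 t01.
set z := _ + _ in hz qz.
have mz : m <= fine (g z).
  rewrite fine_le ?gfin //; have [->|zx0] := eqVneq z x0; first exact: lexx.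
  exact/ltW/gmin.
have rhoz : rho z = 2^-1 * rho x.
  have [_ NZ _] := gnorm_is_norm _ _ _ Gp.
  rewrite /rho -[2^-1]ger0_norm ?invr_ge0 // -NZ; congr gnorm.
  by apply/rowP => i; rewrite !mxE; field.
have rx0 : rho x0 = 0.
  by rewrite /rho subrr is_norm0 //; exact: gnorm_is_norm.
have mE : m = fine (q x0) by rewrite /m gE // rx0 expr0n /= mul0r add0r.
move: mz; rewrite gE // [fine _]/= rhoz gE // lee_fin -/(rho x) => mz.
by move: mz qz; rewrite -mE; lra.
Qed.

(** Quadratic growth on the sphere of radius [r], propagated outward along the ray from [x0] by
    convexity. *)
Lemma linear_growth x : r <= gnorm G (x - x0) ->
  ((m + r * gnorm G (x - x0) / 4)%:E <= g x)%E.
Proof.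
move=> hx; have [[gNy _ gconv _] _] := ga.
have := gNy x; case gx : (g x) => [u| |] // _; last by rewrite leey.
have h0 : rho x0 <= 2 * r.
  by rewrite /rho subrr is_norm0 ?mulr_ge0 ?(ltW r0) //; exact: gnorm_is_norm.
have r0' : 0 < r := r0.
have rx : 0 < rho x by apply: lt_le_trans hx.
pose t := r / rho x.
have t0 : 0 < t by rewrite divr_gt0.
have t01 : 0 <= t <= 1 by rewrite (ltW t0) ler_pdivrMr ?mul1r.
have := gconv x x0 t t01; set z := _ + _ => gz.
have rhoz : rho z = r.
  have [_ NZ _] := gnorm_is_norm _ _ _ Gp.
  transitivity (t * rho x); last by rewrite /t mulfVK // gt_eqF.
  rewrite /rho -[t in RHS]ger0_norm ?(ltW t0) // -NZ; congr gnorm.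
  by apply/rowP => i; rewrite !mxE; ring.
have := quadratic_growth z; rewrite -/(rho z) rhoz => /(_ ltac:(lra)) H.
have := le_trans H gz; rewrite gx -(fineK (gfin _ h0)) -/m -!EFinM -EFinD !lee_fin => H'.
have : t * (m + r * rho x / 4) <= t * u.
  have -> : t * (m + r * rho x / 4) = t * m + r ^+ 2 / 4.
    by rewrite /t; field; rewrite gt_eqF.
  by lra.
by rewrite ler_pM2l.
Qed.

End deformation.

(** * Perturbation of a density *)

Section perturbed_density.
Context d (T : measurableType d) (R : realType) (mu : {measure set T -> \bar R}).
Implicit Types (p q : T -> R) (A B W : set T).

Lemma measurable_ge0_inv p : measurable_fun setT p -> (forall x, 0 <= p x) ->
  measurable_fun setT (fun x => (p x)^-1).
Proof.
move=> mp p0; have -> : (fun x => (p x)^-1) = (fun x => p x `^ (-1)).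
  by apply/funext => x; rewrite powR_inv1.
exact: measurableT_comp (measurable_powR _) mp.
Qed.

Lemma measurable_cst_indic A (a : R) : measurable A ->
  measurable_fun setT (fun x => (a * \1_A x)%:E).
Proof.
by move=> mA; apply/measurable_EFinP; apply: measurable_funM.
Qed.

Lemma integral_cst_indic A (a : R) : measurable A -> 0 <= a ->
  (\int[mu]_x (a * \1_A x)%:E = a%:E * mu A)%E.
Proof.
move=> mA a0; under eq_integral do rewrite EFinM.
rewrite ge0_integralZl_EFin //; first by rewrite integral_indic // setIT.
exact/measurable_EFinP.
Qed.

Lemma cst_indic_ge0 A (a : R) x : 0 <= a -> (0 <= (a * \1_A x)%:E)%E.
Proof. by move=> a0; rewrite lee_fin mulr_ge0 // indicE ler0n. Qed.

(** Corrections are placed on both sides so that no difference of extended integrals is formed. *)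
Lemma le_integral_add_indic p q A B (a b : R) :
  measurable_fun setT p -> measurable_fun setT q ->
  measurable A -> measurable B -> 0 <= a -> 0 <= b ->
  (forall x, 0 <= p x) -> (forall x, 0 <= q x) ->
  (forall x, p x + a * \1_A x <= q x + b * \1_B x) ->
  (\int[mu]_x (p x)%:E + a%:E * mu A <= \int[mu]_x (q x)%:E + b%:E * mu B)%E.
Proof.
move=> mp mq mA mB a0 b0 p0 q0 pq.
rewrite -!integral_cst_indic // -!ge0_integralD //;
  do ?[by move=> x _; exact: cst_indic_ge0|by move=> x _; rewrite lee_fin
      |exact: measurable_cst_indic
      |exact/measurable_EFinP].
apply: ge0_le_integral => //.
- by move=> x _; rewrite adde_ge0 // ?cst_indic_ge0 // lee_fin.
- by apply: emeasurable_funD; [exact/measurable_EFinP|exact: measurable_cst_indic].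
- by apply: emeasurable_funD; [exact/measurable_EFinP|exact: measurable_cst_indic].
- by move=> x _; rewrite -!EFinD lee_fin.
Qed.

(** As [p t] varies only on [B], a set of finite measure, its integral is Lipschitz in [t]; the
    bound at [t = 0] makes all these integrals finite. *)
Lemma integral_ivt (p : R -> T -> R) (B : set T) (c b : R) :
  measurable B -> (mu B < +oo)%E -> 0 <= c -> 0 <= b ->
  (forall t, measurable_fun setT (p t)) -> (forall t x, 0 <= p t x) ->
  (forall s t x, 0 <= s <= b -> 0 <= t <= b ->
     p s x <= p t x + c * `|s - t| * \1_B x) ->
  (\int[mu]_x (p 0 x)%:E <= 1)%E -> (1 <= \int[mu]_x (p b x)%:E)%E ->
  exists2 t, 0 <= t <= b & (\int[mu]_x (p t x)%:E = 1)%E.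
Proof.
move=> mB Boo c0 b0 mp p0 lip J0 Jb.
pose J t := (\int[mu]_x (p t x)%:E)%E.
have Jge0 t : (0 <= J t)%E by apply: integral_ge0 => x _; rewrite lee_fin.
have Bfin : mu B \is a fin_num by rewrite ge0_fin_numE.
have Jlip s t : 0 <= s <= b -> 0 <= t <= b ->
    (J s <= J t + (c * `|s - t| * fine (mu B))%:E)%E.
  move=> s0 t0; have := le_integral_add_indic (p s) (p t) B B 0 (c * `|s - t|)
    (mp s) (mp t) mB mB (lexx _).
  rewrite mul0e adde0 [in X in _ -> X]EFinM fineK //; apply => //.
    by rewrite mulr_ge0.
  by move=> x; rewrite mul0r addr0; exact: lip.
have b00 : 0 <= (0 : R) <= b by rewrite lexx.
have Jfin t : 0 <= t <= b -> J t \is a fin_num.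
  move=> t0; rewrite ge0_fin_numE //; apply: le_lt_trans (Jlip t 0 t0 b00) _.
  by rewrite lte_add_pinfty ?ltry //; apply: le_lt_trans J0 _; rewrite ltry.
have bb : 0 <= b <= b by rewrite b0 lexx.
have [] := @IVT R (fun t => fine (J t)) 0 b 1 b0.
- apply/subspace_continuousP => s; rewrite /= in_itv /= => s0.
  apply/cvgrPdist_le => e e0.
  have D0 : 0 < 1 + c * fine (mu B) by rewrite ltr_pwDl // mulr_ge0 // fine_ge0.
  have H : \forall t \near s, `|s - t| <= e / (1 + c * fine (mu B)).
    by move: (@cvg_id _ (nbhs s)) => /cvgrPdist_le; apply; exact: divr_gt0.
  apply: filterS H => t; rewrite ler_pdivlMr // => st; rewrite /= in_itv /= => t0.
  have h u v (u0 : 0 <= u <= b) (v0 : 0 <= v <= b) :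
      fine (J u) <= fine (J v) + c * `|u - v| * fine (mu B).
    by have := Jlip u v u0 v0;
      rewrite -(fineK (Jfin u u0)) -(fineK (Jfin v v0)) -EFinD lee_fin.
  have h1 := h s t s0 t0; have := h t s t0 s0; rewrite distrC => h2.
  have h3 := normr_ge0 (s - t); rewrite ler_norml /from_subspace.
  by apply/andP; split; lra.
- rewrite ge_min le_max; apply/andP; split; apply/orP.
    by left; rewrite -lee_fin fineK // Jfin.
  by right; rewrite -lee_fin fineK // Jfin.
- move=> t; rewrite in_itv /= => t0 Jt; exists t => //.
  by rewrite -[LHS]/(J t) -(fineK (Jfin t t0)) Jt.
Qed.

(** Where p > 0, q^2/p + p = (q - p)^2/p + 2 q. Integrated with both masses equal to 1, this gives 1
    plus the chi-square distance. *)
Lemma integral_sqr_div_le p q A B (a b : R) :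
  measurable_fun setT p -> measurable_fun setT q ->
  measurable A -> measurable B -> 0 <= a -> 0 <= b ->
  (forall x, 0 <= p x) -> (forall x, 0 <= q x) ->
  (forall x, p x = 0 -> q x = 0) ->
  (\int[mu]_x (p x)%:E = 1)%E -> (\int[mu]_x (q x)%:E = 1)%E ->
  (forall x, (q x - p x) ^+ 2 / p x <= a * \1_A x + b * \1_B x) ->
  (\int[mu]_x (q x ^+ 2 / p x)%:E <= 1 + (a%:E * mu A + b%:E * mu B))%E.
Proof.
move=> mp mq mA mB a0 b0 p0 q0 pq0 p1 q1 pq.
have mpV := measurable_ge0_inv _ mp p0.
have m1 : measurable_fun setT (fun x => (q x ^+ 2 / p x)%:E).
  by apply/measurable_EFinP; apply: measurable_funM => //; exact: measurable_funX.
have m2 : measurable_fun setT (fun x => ((q x - p x) ^+ 2 / p x)%:E).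
  apply/measurable_EFinP; apply: measurable_funM => //; apply: measurable_funX.
  exact: measurable_funB.
have m3 : measurable_fun setT (EFin \o p) by exact/measurable_EFinP.
have m4 : measurable_fun setT (EFin \o q) by exact/measurable_EFinP.
have pos1 x : (0 <= (q x ^+ 2 / p x)%:E)%E by rewrite lee_fin divr_ge0 // sqr_ge0.
have pos2 x : (0 <= ((q x - p x) ^+ 2 / p x)%:E)%E.
  by rewrite lee_fin divr_ge0 // sqr_ge0.
have E : (\int[mu]_x (q x ^+ 2 / p x)%:E + \int[mu]_x (p x)%:E =
    \int[mu]_x ((q x - p x) ^+ 2 / p x)%:E +
    (\int[mu]_x (q x)%:E + \int[mu]_x (q x)%:E))%E.
  rewrite -!ge0_integralD //;
    do ?[by move=> x _; rewrite ?adde_ge0 ?lee_fin|exact: emeasurable_funD].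
  apply: eq_integral => x _; rewrite -!EFinD; congr EFin.
  (* Where [p] vanishes so does [q], and division by zero yields 0. *)
  have [px|px] := eqVneq (p x) 0; last by field.
  by rewrite px (pq0 _ px) invr0 !mulr0 !addr0.
have le2 : (\int[mu]_x ((q x - p x) ^+ 2 / p x)%:E <= a%:E * mu A + b%:E * mu B)%E.
  rewrite -!integral_cst_indic // -ge0_integralD //;
    do ?[by move=> x _; exact: cst_indic_ge0|exact: measurable_cst_indic].
  apply: ge0_le_integral => //.
  - by apply: emeasurable_funD; exact: measurable_cst_indic.
  - by move=> x _; rewrite -EFinD lee_fin.
move: E; rewrite p1 q1 => E.
have -> : (\int[mu]_x (q x ^+ 2 / p x)%:E =
    1 + \int[mu]_x ((q x - p x) ^+ 2 / p x)%:E)%E.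
  by rewrite -[LHS](@addeK _ 1%E) // E addeA addeK // addeC.
by rewrite leeD2l.
Qed.

End perturbed_density.

Lemma dist_maxr_le (R : realDomainType) (a b c : R) :
  `|Num.max a c - Num.max b c| <= `|a - b|.
Proof.
have half u v : Num.max u c <= Num.max v c + `|u - v|.
  have h1 := ler_norm (u - v); have h2 := normr_ge0 (u - v).
  have h3 : v <= Num.max v c by rewrite le_max lexx.
  have h4 : c <= Num.max v c by rewrite le_max lexx orbT.
  by rewrite ge_max; apply/andP; split; lra.
by rewrite ler_distl lerBlDr half distrC half.
Qed.

(** * The deformed density and its chi-square distance to the original *)

Section local_perturbation.
Context (R : realType) (d : nat) (h : \bar R -> \bar R).
Variables (g : 'rV[R]_d -> \bar R) (x0 : 'rV[R]_d) (G : 'M[R]_d).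
Variables (q : 'rV[R]_d -> \bar R) (r : R).
Hypotheses (dh : decreasing_transformation d h) (ga : admissible g).
Hypotheses (gdens : bounded_density (h \o g)) (gmin : unique_min g x0).
Hypotheses (Gp : posdefmx G) (r0 : 0 < r).
Hypothesis qconv : econvex q.
Hypothesis gfin : forall x, gnorm G (x - x0) <= 2 * r -> g x \is a fin_num.
Hypothesis gq : forall x, gnorm G (x - x0) <= 2 * r ->
  g x = ((2^-1 * bform G (x - x0) (x - x0))%:E + q x)%E.
Let m := fine (g x0).
Variables (e k H : R).
Hypotheses (e0 : 0 < e) (k0 : 0 < k) (H0 : 0 < H).
Hypothesis hfin : forall y, `|y - m| <= e -> h y%:E \is a fin_num.
Hypothesis hlow : forall y, `|y - m| <= e -> H / 2 <= hreal h y.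
Hypothesis hslope : forall y z, m - e <= y -> y <= z -> z <= m + e ->
  k / 2 * (z - y) <= hreal h y - hreal h z <= 2 * k * (z - y).
Hypothesis gle : forall x, gnorm G (x - x0) <= r -> fine (g x) <= m + e / 2.
Variables (N : 'rV[R]_d -> R) (Nn : is_norm N).

Let mu : {measure set 'rV[R]_d -> \bar R} := lebesgue_rV R d.
Let rho (x : 'rV[R]_d) := gnorm G (x - x0).
Let B := ellipsoid R G x0 (r ^+ 2).
Let W := ellipsoid R G x0 ((r / 2) ^+ 2).
Let p x := fine (h (g x)).

(** The bound of [lebesgue_ellipsoid_le] at level 12 eps. Where rho^2 > 12 eps in the ball, [g]
    exceeds [m] by more than 3 eps; the lowering takes at most eps and the tilted norm is at most m
    + 2 eps, so the latter can prevail only on this ellipsoid. *)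
Definition sublevel_volume (G : 'M[R]_d) (eps : R) : R :=
  (2 * Num.sqrt (12 * eps)) ^+ d / Num.sqrt (\det G).

Let ellE s x : 0 <= s -> ellipsoid R G x0 (s ^+ 2) x <-> rho x <= s.
Proof.
move=> s0; rewrite /ellipsoid /= -sqr_gnorm // ler_sqr ?nnegrE //.
exact: gnorm_ge0.
Qed.

Let r2_ge0 : 0 <= r / 2.
Proof. by rewrite divr_ge0 // ltW. Qed.

Let mell s : measurable (ellipsoid R G x0 s).
Proof. exact: measurable_ellipsoid. Qed.

Let ell_fin s : 0 <= s -> mu (ellipsoid R G x0 s) \is a fin_num.
Proof.
move=> s0; rewrite ge0_fin_numE //.
by apply: (le_lt_trans (lebesgue_ellipsoid_le _ _ G x0 s Gp s0)); rewrite ltry.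
Qed.

Lemma lebesgue_ellipsoid_gt0 s : 0 < s -> (0 < mu (ellipsoid R G x0 (s ^+ 2)))%E.
Proof.
move=> s0; have [t t0 Ht] : exists2 t : R, 0 < t &
    forall x, `|x - x0| < t -> gnorm G (x - x0) <= s.
  have := is_norm_continuous _ _ _ (gnorm_is_norm _ _ _ Gp) 0.
  rewrite /continuous_at is_norm0; last exact: gnorm_is_norm.
  move=> /cvgrPdist_le/(_ s s0)/nbhs_ballP[t /= t0 Ht]; exists t => // x xt.
  have := Ht (x - x0); rewrite mx_norm_ball /ball_ /= sub0r normrN => /(_ xt).
  by rewrite sub0r normrN ger0_norm ?gnorm_ge0.
apply: lt_le_trans (lebesgue_box_gt0 R d x0 t t0) _.
apply: le_measure; rewrite ?inE //; first exact: measurable_box.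
move=> x xb; apply/ellE; first exact: ltW.
by apply: Ht; exact: box_ball.
Qed.

Let h_lip y z : m - e <= y <= m + e -> m - e <= z <= m + e ->
  `|hreal h y - hreal h z| <= 2 * k * `|y - z|.
Proof.
have k0' : 0 < k := k0.
move=> /andP[y1 y2] /andP[z1 z2]; have [yz|zy] := leP y z.
  have /andP[a1 a2] := hslope y z y1 yz z2.
  rewrite ger0_norm; last by apply: le_trans a1; rewrite mulr_ge0; lra.
  by rewrite ler0_norm ?opprB //; lra.
have /andP[a1 a2] := hslope z y z1 (ltW zy) y2.
rewrite ler0_norm ?opprB; last first.
  by rewrite -oppr_ge0 opprB; apply: le_trans a1; rewrite mulr_ge0; lra.
by rewrite ger0_norm //; lra.
Qed.

Let rho0 : rho x0 = 0.
Proof. by rewrite /rho subrr is_norm0 //; exact: gnorm_is_norm. Qed.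

Let gx0 : g x0 = m%:E.
Proof. by rewrite fineK // gfin // -/(rho x0) rho0 mulr_ge0 // ltW. Qed.

Let g_ge x : (m%:E <= g x)%E.
Proof.
rewrite -gx0; have [->|xx0] := eqVneq x x0; first exact: lexx.
exact/ltW/gmin.
Qed.

Let gE x : rho x <= r -> g x = (fine (g x))%:E.
Proof. by move=> hx; rewrite fineK // gfin // (le_trans hx) // ler_peMl ?(ltW r0) ?ler1n. Qed.

Let g_in x : rho x <= r -> m <= fine (g x) <= m + e / 2.
Proof. by move=> hx; rewrite gle // andbT -lee_fin -(gE _ hx); exact: g_ge. Qed.

Let g_quad x : rho x <= r -> m + rho x ^+ 2 / 4 <= fine (g x).
Proof.
move=> hx; rewrite -lee_fin -(gE _ hx).
apply: (quadratic_growth _ _ g x0 G q r) => //.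
by rewrite (le_trans hx) // ler_peMl ?(ltW r0) ?ler1n.
Qed.

Let pE x : (h (g x)) = (p x)%:E.
Proof.
rewrite fineK // ge0_fin_numE ?(dt_ge0 dh) //.
have [_ [M HM]] := gdens.
by apply: le_lt_trans (HM x) _; rewrite ltry.
Qed.

Let p_ge0 x : 0 <= p x.
Proof. by rewrite -lee_fin -pE (dt_ge0 dh). Qed.

Let mp : measurable_fun setT p.
Proof.
have [[mg _ _] _] := gdens; apply: measurableT_comp mg; exact: fine_measurable.
Qed.

Let p1 : (\int[mu]_x (p x)%:E = 1)%E.
Proof.
have [[_ _ <-] _] := gdens; apply: eq_integral => x _; by rewrite -pE.
Qed.

Section fixed_height.
Variables (eps : R) (x1 : 'rV[R]_d).
Hypotheses (eps0 : 0 < eps) (eps_e : eps <= e / 4) (eps_r : 8 * eps <= r ^+ 2).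
Hypothesis gx1 : (g x1 <= (m + eps)%:E)%E.
Let VA := sublevel_volume G eps.
Hypothesis VA_small : VA <= fine (mu W) ^+ 2 / (1024 * fine (mu B)).

Let A := ellipsoid R G x0 (12 * eps).

Let K : R := sval (cid2 (is_norm_le_mx_norm _ _ _ Nn)) * sval (cid2 (mx_norm_le_gnorm _ _ _ Gp)).

Let K_gt0 : 0 < K.
Proof. by rewrite /K; case: cid2 => ? ? ? /=; case: cid2 => ? ? ? /=; rewrite mulr_gt0. Qed.

Let NK x : N (x - x0) <= K * rho x.
Proof.
rewrite /K; case: cid2 => a a0 Ha /=; case: cid2 => b b0 Hb /=.
by rewrite -mulrA (le_trans (Ha _)) // ler_wpM2l ?(ltW a0).
Qed.

(** [D] bounds N(x - x1) over the ball of radius [r], so that the tilt with slope eps/D adds at most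
    eps there. *)
Let D := K * r + N (x0 - x1) + 1.
Let D0 : 0 < D.
Proof. by rewrite ltr_wpDl // addr_ge0 ?is_norm_ge0 // mulr_ge0 ?(ltW K_gt0) ?(ltW r0). Qed.
Let eta := eps / D.
Let eta0 : 0 < eta. Proof. by rewrite divr_gt0. Qed.

Let psi x := m + eps + eta * N (x - x1).

Let psi_ge x : m + eps <= psi x.
Proof. by rewrite lerDl mulr_ge0 ?is_norm_ge0 // ltW. Qed.

Let N_le x : N (x - x1) <= K * rho x + N (x0 - x1).
Proof.
have [ND _ _] := Nn; have := ND (x - x0) (x0 - x1).
by rewrite addrA subrK; have := NK x; lra.
Qed.

Let psi_in x : rho x <= r -> psi x <= m + 2 * eps.
Proof.
move=> hx; have h1 : N (x - x1) <= D.
  rewrite (le_trans (N_le x)) // /D.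
  have := ler_wpM2l (ltW K_gt0) hx; lra.
have := ler_wpM2l (ltW eta0) h1; rewrite /psi {2}/eta mulfVK ?gt_eqF //.
by lra.
Qed.

(** The tilt grows at most like eps rho / r, hence psi <= m + 2 eps rho / r here; the condition 8
    eps <= r^2 puts this below the linear growth of [g]. *)
Let psi_out x : r <= rho x -> psi x <= m + r * rho x / 4.
Proof.
move=> hx; have r0' : 0 < r := r0; have eps0' : 0 < eps := eps0.
have h1 : r * N (x - x1) <= D * rho x.
  have h2 := ler_wpM2l (ltW r0) (N_le x).
  have h3 := ler_wpM2l (is_norm_ge0 _ _ _ (x0 - x1) Nn) hx.
  by rewrite /D; lra.
have h2 : r * (eta * N (x - x1)) <= eps * rho x.
  have -> : eps = eta * D by rewrite /eta mulfVK ?gt_eqF.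
  have := ler_wpM2l (ltW eta0) h1; lra.
have h3 := ler_wpM2l (ltW eps0) hx.
have h4 : 8 * eps * rho x <= r ^+ 2 * rho x.
  by rewrite ler_wpM2r // (le_trans (ltW r0)).
rewrite -(@ler_pM2l _ r) // /psi; lra.
Qed.

Let psi_cont : continuous psi.
Proof.
move=> x; have cM : eta * N (y - x1) @[y --> x] --> eta * N (x - x1).
  exact: cvgMl_tmp (is_norm_subr_continuous _ _ _ x1 Nn x).
exact: cvgD (@cst_continuous _ _ (m + eps) x) cM.
Qed.

Let psi_conv : econvex (fun x => (psi x)%:E).
Proof.
move=> x y t t01; rewrite -!EFinM -EFinD lee_fin /psi.
have := ler_wpM2l (ltW eta0) (is_norm_convex _ _ N x1 x y t Nn t01).
by lra.
Qed.

Let f th := deform R d g x0 G r th psi.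

Let f_out th x : r <= rho x -> f th x = g x.
Proof.
move=> hx; rewrite /f /deform /lowered bump_out // mulr0 sube0.
apply/max_idPl; apply: (@le_trans _ _ (m + r * rho x / 4)%:E).
  by rewrite lee_fin psi_out.
exact: (linear_growth _ _ g x0 G q r).
Qed.

Let dr th x := Num.max (fine (g x) - th * bump r (rho x)) (psi x).

Let f_in th x : rho x <= r -> f th x = (dr th x)%:E.
Proof.
move=> hx; rewrite /f /deform /lowered -/(rho x) [in LHS]gE // -EFinB.
by rewrite -EFin_max.
Qed.

Let pt th x := fine (h (f th x)).

Let f_ge th x : ((m + eps)%:E <= f th x)%E.
Proof. by rewrite le_max !lee_fin psi_ge orbT. Qed.

Let m_in : `|m - m| <= e. Proof. by rewrite subrr normr0 ltW. Qed.

Let hf_le th x : (h (f th x) <= h m%:E)%E.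
Proof.
apply: (dt_noninc dh); apply: le_trans (f_ge th x).
by rewrite lee_fin lerDl ltW.
Qed.

Let ptE th x : h (f th x) = (pt th x)%:E.
Proof.
rewrite fineK // ge0_fin_numE ?(dt_ge0 dh) //.
by apply: le_lt_trans (hf_le th x) _; rewrite -(fineK (hfin _ m_in)) ltry.
Qed.

Let pt_ge0 th x : 0 <= pt th x.
Proof. by rewrite -lee_fin -ptE (dt_ge0 dh). Qed.

Let mhf th : measurable_fun setT (h \o f th).
Proof.
apply: measurableT_comp; first exact: measurable_transformation dh.
apply: lower_semicontinuous_measurable; apply: lower_semicontinuous_max.
  exact: lowered_lsc.
exact: continuous_lower_semicontinuous.
Qed.

Let mpt th : measurable_fun setT (pt th).
Proof. apply: measurableT_comp (mhf th); exact: fine_measurable. Qed.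

Let vW := fine (mu W).
Let vB := fine (mu B).
Let vW0 : 0 < vW.
Proof.
by rewrite fine_gt0 // lebesgue_ellipsoid_gt0 ?divr_gt0 //= -ge0_fin_numE // ell_fin ?sqr_ge0.
Qed.

Let vWB : vW <= vB.
Proof.
rewrite fine_le ?ell_fin ?sqr_ge0 //; apply: le_measure;
  [by rewrite inE; exact: mell|by rewrite inE; exact: mell|].
move=> x /(ellE _ x r2_ge0) xW; apply/ellE; first exact: ltW.
rewrite (le_trans xW) //.
by rewrite ler_pdivrMr // ler_peMr ?(ltW r0) ?ler1n.
Qed.

Let VA0 : 0 <= VA.
Proof. by rewrite divr_ge0 ?exprn_ge0 ?mulr_ge0 ?sqrtr_ge0. Qed.

Let VAW : 1024 * VA <= vW.
Proof.
have vB0 : 0 < vB := lt_le_trans vW0 vWB.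
have c0 : 0 < 1024 * vB by rewrite mulr_gt0 ?ltr0n.
have h1 : VA * (1024 * vB) <= vW ^+ 2 by rewrite -ler_pdivlMr ?c0.
rewrite -(ler_pM2r vB0) mulrAC (mulrC (1024 * vB)) (le_trans h1) // expr2.
by rewrite ler_wpM2l // ltW.
Qed.

Let muA : (mu A <= VA%:E)%E.
Proof. by apply: lebesgue_ellipsoid_le => //; rewrite mulr_ge0 // ltW. Qed.

(** The end of the range for [th]. At [ts] the density gains at least k ts r^2/16 on [W] without
    [A], a set of volume at least vW/2, and loses at most 4 k eps on [A], of volume at most [VA].
    Equating gain and loss gives 128. *)
Let ts := 128 * eps * VA / (r ^+ 2 * vW).

Let ts0 : 0 <= ts.
Proof. by rewrite divr_ge0 ?mulr_ge0 ?sqr_ge0 // ltW. Qed.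

Let tsE : ts * (r ^+ 2 * vW) = 128 * eps * VA.
Proof. by rewrite /ts mulfVK // gt_eqF // mulr_gt0 // exprn_gt0. Qed.

Let ts_small : ts * r ^+ 2 <= eps / 8.
Proof.
have vW0' := vW0.
rewrite -(@ler_pM2r _ vW) // -mulrA tsE.
have := ler_wpM2l (ltW eps0) VAW; lra.
Qed.

Let bump_in x : 0 <= bump r (rho x) <= r ^+ 2 / 2.
Proof. by rewrite bump_ge0 bump_le ?gnorm_ge0 // ltW. Qed.

Let th_small th x : 0 <= th <= ts -> 0 <= th * bump r (rho x) <= eps.
Proof.
move=> /andP[t0 t1]; have /andP[b0 b1] := bump_in x.
rewrite mulr_ge0 //=; have := ler_pM t0 b0 t1 b1.
by have := ts_small; have := eps0; lra.
Qed.

Let dr_in th x : rho x <= r -> 0 <= th <= ts -> m + eps <= dr th x <= m + e / 2.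
Proof.
move=> hx ht; have /andP[b0 b1] := th_small th x ht.
have /andP[g1 g2] := g_in _ hx.
rewrite le_max psi_ge orbT ge_max /=; apply/andP; split; first by lra.
by have := psi_in _ hx; have := eps_e; lra.
Qed.

Let pt_in th x : rho x <= r -> pt th x = hreal h (dr th x).
Proof. by move=> hx; rewrite /pt f_in. Qed.

Let p_in x : rho x <= r -> p x = hreal h (fine (g x)).
Proof. by move=> hx; rewrite /p [in LHS]gE. Qed.

Let pt_out th x : r <= rho x -> pt th x = p x.
Proof. by move=> hx; rewrite /pt f_out. Qed.

Let pt_lip s t x : rho x <= r -> 0 <= s <= ts -> 0 <= t <= ts ->
  `|pt s x - pt t x| <= k * r ^+ 2 * `|s - t|.
Proof.
move=> hx hs ht; rewrite !pt_in //.
have /andP[s1 s2] := dr_in _ _ hx hs; have /andP[t1 t2] := dr_in _ _ hx ht.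
have e0' := e0; have eps0' := eps0.
apply: (le_trans (h_lip _ _ _ _)); try (apply/andP; split; lra).
have /andP[b0 b1] := bump_in x.
have -> : k * r ^+ 2 * `|s - t| = 2 * k * (`|s - t| * (r ^+ 2 / 2)) by field.
rewrite ler_wpM2l ?mulr_ge0 ?(ltW k0) //.
apply: (@le_trans _ _ (`|s - t| * bump r (rho x))); last by rewrite ler_wpM2l.
apply: (le_trans (dist_maxr_le _ _ _ _)).
have -> : fine (g x) - s * bump r (rho x) - (fine (g x) - t * bump r (rho x)) =
    (t - s) * bump r (rho x) by ring.
by rewrite normrM distrC (ger0_norm b0).
Qed.

Let pt0_le x : pt 0 x <= p x.
Proof.
rewrite -lee_fin -ptE -pE; apply: (dt_noninc dh).
by rewrite /f /deform /lowered mul0r sube0 le_max lexx.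
Qed.

(* Off [A], the lowered function is above [psi], as [rho^2 > 12 eps]. *)
Let dr_notA th x : rho x <= r -> 0 <= th <= ts -> ~ A x ->
  dr th x = fine (g x) - th * bump r (rho x).
Proof.
move=> hx ht xA; apply/max_idPl.
have : 12 * eps < rho x ^+ 2.
  by rewrite ltNge; apply/negP => H'; apply: xA; rewrite /A /ellipsoid /= -sqr_gnorm.
have /andP[b0 b1] := th_small th x ht.
have := psi_in _ hx; have := g_quad _ hx; lra.
Qed.

Let pt_A th x : rho x <= r -> 0 <= th <= ts -> `|pt th x - p x| <= 4 * k * eps.
Proof.
move=> hx ht; rewrite pt_in // p_in //.
have /andP[d1 d2] := dr_in _ _ hx ht; have /andP[g1 g2] := g_in _ hx.
have e0' := e0; have eps0' := eps0.
apply: (le_trans (h_lip _ _ _ _)); try (apply/andP; split; lra).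
have -> : 4 * k * eps = 2 * k * (2 * eps) by ring.
rewrite ler_wpM2l ?mulr_ge0 ?(ltW k0) // ler_norml.
have /andP[b0 b1] := th_small th x ht; have := psi_in _ hx => p2.
have dge : fine (g x) - th * bump r (rho x) <= dr th x by rewrite le_max lexx.
have dle : dr th x <= fine (g x) + 2 * eps by rewrite ge_max; apply/andP; split; lra.
by apply/andP; split; lra.
Qed.

Let pt_notA th x : rho x <= r -> 0 <= th <= ts -> ~ A x ->
  p x + k / 2 * (th * bump r (rho x)) <= pt th x <= p x + k * ts * r ^+ 2.
Proof.
move=> hx ht xA; rewrite pt_in // p_in //.
have /andP[d1 d2] := dr_in _ _ hx ht; have /andP[g1 g2] := g_in _ hx.
have /andP[b0 b1] := th_small th x ht.
rewrite dr_notA // in d1 d2 *; have e0' := e0; have eps0' := eps0.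
have := hslope (fine (g x) - th * bump r (rho x)) (fine (g x))
  ltac:(lra) ltac:(lra) ltac:(lra).
rewrite subKr => /andP[h1 h2].
have : th * bump r (rho x) <= ts * (r ^+ 2 / 2).
  case/andP: ht => t0 t1; have /andP[? ?] := bump_in x.
  exact: ler_pM.
move=> h3; have := ler_wpM2l (ltW k0) h3 => h4.
by apply/andP; split; lra.
Qed.

Let tsI : 0 <= ts <= ts. Proof. by rewrite ts0 lexx. Qed.

Let mass_le : (1 <= \int[mu]_x (pt ts x)%:E)%E.
Proof.
have mA : measurable A by exact: mell.
have mWA : measurable (W `\` A) by apply: measurableD; exact: mell.
have Afin : mu A \is a fin_num by rewrite ell_fin // mulr_ge0 // ltW.
have Wfin : mu W \is a fin_num by rewrite ell_fin // sqr_ge0.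
have WAfin : mu (W `\` A) \is a fin_num.
  rewrite ge0_fin_numE //; apply: (@le_lt_trans _ _ (mu W)).
    by apply: le_measure; rewrite ?inE //; exact: mell.
  by rewrite -ge0_fin_numE.
have v0 : 0 <= k * ts * r ^+ 2 / 16.
  by rewrite divr_ge0 ?ler0n // mulr_ge0 ?sqr_ge0 // mulr_ge0 // ltW.
have u0 : 0 <= 4 * k * eps by rewrite mulr_ge0 ?(ltW eps0) // mulr_ge0 ?ler0n ?(ltW k0).
have := le_integral_add_indic _ _ _ mu p (pt ts) (W `\` A) A _ _ mp (mpt ts) mWA mA
  v0 u0 p_ge0 (pt_ge0 ts).
rewrite p1 => Hint.
have {Hint} : (1 + (k * ts * r ^+ 2 / 16)%:E * mu (W `\` A) <=
    \int[mu]_x (pt ts x)%:E + (4 * k * eps)%:E * mu A)%E.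
  apply: Hint => x.
  have [xA|xA] := pselect (A x).
    rewrite (@indicE _ _ (W `\` A)) memNset ?mulr0 ?addr0; last by case.
    rewrite indicE mem_set // mulr1.
    have [hx|hx] := leP (rho x) r; last by rewrite pt_out ?lerDl // ltW.
    by have := pt_A ts x hx tsI; rewrite ler_norml => /andP[+ _]; lra.
  rewrite (@indicE _ _ A) memNset // mulr0 addr0.
  have [hx|hx] := leP (rho x) r; last first.
    rewrite pt_out ?(ltW hx) // indicE memNset ?mulr0 ?addr0 // => -[/(ellE _ x r2_ge0) xW _].
    by have := r0; move: hx xW; lra.
  have /andP[h1 _] := pt_notA ts x hx tsI xA.
  have [xW|xW] := pselect (W x); last first.
    rewrite indicE memNset ?mulr0 ?addr0; last by case.
    apply: le_trans h1; rewrite lerDl mulr_ge0 //; first by rewrite divr_ge0 // ltW.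
    by rewrite mulr_ge0 // bump_ge0.
  rewrite indicE mem_set // mulr1 (le_trans _ h1) // lerD2l.
  have h2 : r ^+ 2 / 8 <= bump r (rho x).
    by rewrite bump_ge ?(ltW r0) //; apply/ellE.
  have := ler_wpM2l ts0 h2 => h3; have := ler_wpM2l (ltW k0) h3; lra.
have J0 : (0 <= \int[mu]_x (pt ts x)%:E)%E.
  by apply: integral_ge0 => x _; rewrite lee_fin.
move: J0; case: (\int[mu]_x _)%E => [J| |] // J0; last by rewrite leey.
rewrite -(fineK WAfin) -(fineK Afin) -!EFinM -!EFinD !lee_fin => Hint.
have WE : vW <= fine (mu (W `\` A)) + fine (mu A).
  rewrite -lee_fin EFinD !fineK //.
  rewrite (measureDI mu (mell _ : measurable W) mA) leeD2l //.
  by apply: le_measure; rewrite ?inE //; apply: measurableI => //; exact: mell.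
have Ale : fine (mu A) <= VA by rewrite -lee_fin fineK.
(* [VA] is at most vW/1024, so that removing [A] leaves at least half of [W]. *)
have h1 : vW / 2 <= fine (mu (W `\` A)) by have := VAW; have := VA0; lra.
have h2 := ler_wpM2l v0 h1.
have h3 := ler_wpM2l u0 Ale.
have h4 : k * ts * r ^+ 2 / 16 * (vW / 2) = k * (ts * (r ^+ 2 * vW)) / 32 by field.
rewrite h4 tsE in h2; lra.
Qed.

(** [th] is found between 0, where the maximum with [psi] can only remove mass, and [ts], where the
    mass is at least 1. The constant 64 is 32 for a change of at most 4 k eps on [A], plus 32 for
    the compensation on the rest of [B]. *)
Lemma perturbed_density : exists f' : 'rV[R]_d -> \bar R,
  [/\ admissible f', unique_min f' x1, f' x1 = (m + eps)%:E,
      bounded_density (h \o f') &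
      (forall x, fine (h (g x)) = 0 -> fine (h (f' x)) = 0) /\
      (\int[mu]_x (fine (h (f' x)) ^+ 2 / fine (h (g x)))%:E <=
        1 + (64 * k ^+ 2 * eps ^+ 2 / H * sublevel_volume G eps)%:E)%E].
Proof.
have mA : measurable A by exact: mell.
have mB : measurable B by exact: mell.
have Bfin : mu B \is a fin_num by rewrite ell_fin // sqr_ge0.
have r20 : 0 < r ^+ 2 by rewrite exprn_gt0.
have [th ht mass] : exists2 th, 0 <= th <= ts & (\int[mu]_x (pt th x)%:E = 1)%E.
  apply: (integral_ivt _ _ _ mu pt B (k * r ^+ 2) ts) => //.
  - by rewrite -ge0_fin_numE.
  - by rewrite mulr_ge0 ?(ltW r20) // ltW.
  - move=> s t x hs ht; rewrite indicE; have [hx|hx] := leP (rho x) r.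
      rewrite mem_set; last by apply/ellE => //; exact: ltW.
      by have := pt_lip s t x hx hs ht; rewrite mulr1 ler_norml => /andP[_]; lra.
    rewrite !pt_out ?(ltW hx) // lerDl mulr_ge0 // ?ler0n //.
    by rewrite !mulr_ge0 // ltW.
  - rewrite -p1; apply: ge0_le_integral => //.
    + by move=> x _; rewrite lee_fin.
    + exact/measurable_EFinP.
    + exact/measurable_EFinP.
    + by move=> x _; rewrite lee_fin.
exists (f th).
have th01 : 0 <= th <= 1.
  case/andP: ht => -> /= t1; apply: (le_trans t1).
  rewrite -(@ler_pM2r _ (r ^+ 2)) // mul1r (le_trans ts_small) //.
  by have := eps_r; have := eps0; lra.
(* At [x1] the tilt vanishes, and the lowered function is at most g x1 <= m + eps, so [psi] is the
   maximum. *)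
have fx1 : f th x1 = (m + eps)%:E.
  rewrite /f /deform (_ : psi x1 = m + eps); last first.
    by rewrite /psi subrr is_norm0 // mulr0 addr0.
  apply/max_idPr; apply: le_trans gx1; rewrite /lowered leeBlDr // leeDl //.
  by rewrite lee_fin mulr_ge0 ?bump_ge0 //; case/andP: ht.
split => //.
- exact: (deform_admissible _ _ g x0 G q r).
- move=> y yx1; rewrite fx1 lt_max; apply/orP; right.
  rewrite lte_fin ltrDl mulr_gt0 // lt_neqAle is_norm_ge0 // andbT eq_sym.
  have [_ _ Nd] := Nn; apply: contra yx1 => /eqP/Nd/eqP.
  by rewrite subr_eq0.
- split.
    split; [exact: mhf|by move=> x; exact: dt_ge0 dh _|].
    by rewrite -[RHS]mass; apply: eq_integral => x _; rewrite -ptE.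
  exists (fine (h m%:E)) => x; rewrite fineK ?hf_le //; exact: hfin.
(* On the ball [p] is at least H/2: the quotients are bounded there, and [p] can vanish only where
   nothing was changed. *)
have p_pos x : rho x <= r -> H / 2 <= p x.
  move=> hx; rewrite p_in //; apply: hlow.
  have /andP[g1 g2] := g_in _ hx; have := e0.
  by rewrite ler_norml => ?; apply/andP; split; lra.
have H0' := H0; split.
  move=> x px; have [hx|hx] := leP (rho x) r.
    by have := p_pos _ hx; rewrite /p px; lra.
  by rewrite -/(pt th x) pt_out ?(ltW hx).
pose a := (4 * k * eps) ^+ 2 / (H / 2); pose b := (k * ts * r ^+ 2) ^+ 2 / (H / 2).
have a0 : 0 <= a by rewrite divr_ge0 ?sqr_ge0 ?divr_ge0 // ltW.
have b0 : 0 <= b by rewrite divr_ge0 ?sqr_ge0 ?divr_ge0 // ltW.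
have sq (u v c : R) : `|u| <= v -> H / 2 <= c -> u ^+ 2 / c <= v ^+ 2 / (H / 2).
  move=> uv Hc; have c0 : 0 < c by lra.
  rewrite ler_pM ?sqr_ge0 ?invr_ge0 ?(ltW c0) //.
    by rewrite -real_normK ?num_real // ler_sqr ?nnegrE // (le_trans _ uv).
  by rewrite lef_pV2 ?posrE // divr_gt0.
have zero : forall x, p x = 0 -> pt th x = 0.
  move=> x px; have [hx|hx] := leP (rho x) r; first by have := p_pos _ hx; rewrite px; lra.
  by rewrite pt_out ?(ltW hx).
apply: (le_trans (integral_sqr_div_le _ _ _ mu p (pt th) A B a b mp (mpt th) mA mB a0 b0
  p_ge0 (pt_ge0 th) zero p1 mass _)).
  move=> x; have [hx|hx] := leP (rho x) r; last first.
    rewrite pt_out ?(ltW hx) // subrr expr0n /= mul0r addr_ge0 // mulr_ge0 // indicE ler0n //.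
  have [xA|xA] := pselect (A x).
    rewrite [\1_A x]indicE mem_set // mulr1; apply: (@le_trans _ _ a).
      by apply: sq; [exact: pt_A|exact: p_pos].
    by rewrite lerDl mulr_ge0 // indicE ler0n.
  rewrite [\1_A x]indicE memNset // mulr0 add0r indicE mem_set; last first.
    by apply/ellE => //; exact: ltW.
  rewrite mulr1 /b; apply: sq; last exact: p_pos.
  have /andP[h1 h2] := pt_notA th x hx ht xA.
  rewrite ger0_norm ?lerBlDl // subr_ge0 (le_trans _ h1) // lerDl.
  rewrite mulr_ge0 ?divr_ge0 ?(ltW k0) //; by have /andP[] := th_small th x ht.
have Afin : mu A \is a fin_num by rewrite ell_fin // mulr_ge0 // ltW.
rewrite leeD2l // -(fineK Afin) -(fineK Bfin) -!EFinM -EFinD lee_fin -/VA.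
have Ale : fine (mu A) <= VA by rewrite -lee_fin fineK.
have h1 := ler_wpM2l a0 Ale.
have vB0 : 0 < vB := lt_le_trans vW0 vWB.
(* The compensation is quadratic in [VA]. The smallness hypothesis, 1024 VA vB <= vW^2, turns one
   factor [VA] into a constant, and 2 times 128^2 / 1024 is 32. *)
suff h2 : b * vB <= 32 * k ^+ 2 * eps ^+ 2 / H * VA.
  have -> : 64 * k ^+ 2 * eps ^+ 2 / H * VA =
      a * VA + 32 * k ^+ 2 * eps ^+ 2 / H * VA.
    by rewrite /a; field; rewrite gt_eqF.
  by apply: lerD.
have -> : b = 2 * k ^+ 2 / H * (128 * eps * VA / vW) ^+ 2.
  rewrite /b -tsE; field; rewrite gt_eqF //= gt_eqF //.
have h3 : VA * (1024 * vB) <= vW ^+ 2.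
  have c1 : 0 < 1024 * vB by rewrite mulr_gt0 ?ltr0n.
  by rewrite -ler_pdivlMr ?c1.
have c0 : 0 <= 32 * k ^+ 2 * eps ^+ 2 / H * VA / vW ^+ 2.
  by rewrite !mulr_ge0 ?invr_ge0 ?sqr_ge0 // ltW.
have := ler_wpM2l c0 h3.
have -> : 32 * k ^+ 2 * eps ^+ 2 / H * VA / vW ^+ 2 * (VA * (1024 * vB)) =
  2 * k ^+ 2 / H * (128 * eps * VA / vW) ^+ 2 * vB.
  by field; rewrite !gt_eqF.
by move=> /le_trans; apply; rewrite mulfVK // gt_eqF // exprn_gt0.
Qed.

End fixed_height.

End local_perturbation.

(** * Two-point lower bound *)

Section two_point.
Context (R : realType) (d : nat).
Implicit Types (p q : 'rV[R]_d -> R).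

(** The bound (1 + c)^k <= 1 + 2 k c propagates as long as 2 k c <= 1. *)
Lemma expr_le2 (c : R) n : 0 <= c -> 2 * n%:R * c <= 1 -> (1 + c) ^+ n <= 2.
Proof.
move=> c0 nc; suff H k : (k <= n)%N -> (1 + c) ^+ k <= 1 + 2 * k%:R * c.
  by apply: (le_trans (H n (leqnn n))); lra.
elim: k => [|k IH] kn; first by rewrite expr0 mulr0 mul0r addr0.
have h1 := ler_wpM2l (_ : 0 <= 1 + c) (IH (ltnW kn)).
rewrite exprS (le_trans (h1 _)) //; first by rewrite addr_ge0.
have h2 : 2 * k%:R * c <= 1.
  apply: le_trans nc; rewrite ler_wpM2r // ler_wpM2l // ler_nat; exact: ltnW.
have := ler_wpM2l c0 h2; rewrite -natr1; lra.
Qed.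

(* If [u < v], this is [(2 u - v)^2 >= 0]; the junk value v/0 = 0 does no harm
   since [u = 0] implies [v = 0]. *)
Lemma two_point_pointwise (u v s t D : R) : 0 <= u -> 0 <= v -> (u = 0 -> v = 0) ->
  0 <= s -> 0 <= t -> 0 <= D -> D <= s + t ->
  D * v <= u * s + v * t + D / 4 * (v ^+ 2 / u).
Proof.
move=> u0 v0 uv s0 t0 D0 Dst.
have [u00|un0] := eqVneq u 0.
  by rewrite uv // mulr0 !mul0r u00 !mul0r expr0n /= !mul0r mulr0 !addr0.
have {un0}up : 0 < u by rewrite lt_neqAle eq_sym un0.
have w0 : 0 <= v ^+ 2 / u by rewrite divr_ge0 ?sqr_ge0.
have h1 : Num.min u v * D <= u * s + v * t.
  have m0 : 0 <= Num.min u v by rewrite le_min u0.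
  apply: (le_trans (ler_wpM2l m0 Dst)); rewrite mulrDr.
  by apply: lerD; rewrite ler_wpM2r // ge_min lexx ?orbT.
have h2 : v <= Num.min u v + v ^+ 2 / u / 4.
  have [uv'|vu] := leP u v; last by rewrite lerDl divr_ge0.
  rewrite -(@ler_pM2r _ u) // mulrDl.
  have -> : v ^+ 2 / u / 4 * u = v ^+ 2 / 4 by field; rewrite gt_eqF.
  by have := sqr_ge0 (2 * u - v); nra.
have := ler_wpM2l D0 h2; lra.
Qed.

Lemma prode_EFin (I : Type) (s : seq I) (F : I -> R) :
  (\prod_(i <- s) (F i)%:E)%E = (\prod_(i <- s) F i)%:E.
Proof. by elim/big_ind2: _ => // _ x _ y -> ->. Qed.

Lemma iid_expectationE n p (F : n.-tuple 'rV[R]_d -> R) :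
  iid_expectation (fun x => (p x)%:E) (fun x => (F x)%:E) =
  (\int[prod_measure (@lebesgue_rV R d) n]_x
    ((\prod_(i < n) p (tnth x i)) * F x)%:E)%E.
Proof. by apply: eq_integral => x _; rewrite prode_EFin. Qed.

Let mu := lebesgue_rV R d.

(** [two_point_pointwise] is integrated for the product densities. The integral of Q^2/P is the n-th
    power of that of q^2/p, hence at most 2, so the last term takes back only half of the
    distance. *)
Lemma two_point_expectation (N : 'rV[R]_d -> R) n p q (a b : 'rV[R]_d) (c : R)
    (t : n.-tuple 'rV[R]_d -> 'rV[R]_d) :
  is_norm N -> measurable_fun setT p -> measurable_fun setT q ->
  (forall x, 0 <= p x) -> (forall x, 0 <= q x) -> (forall x, p x = 0 -> q x = 0) ->
  (\int[mu]_x (q x)%:E = 1)%E -> 0 <= c -> 2 * n%:R * c <= 1 ->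
  (\int[mu]_x (q x ^+ 2 / p x)%:E <= 1 + c%:E)%E -> measurable_fun setT t ->
  ((N (b - a) / 2)%:E <=
   iid_expectation (fun x => (p x)%:E) (fun x => (N (t x - a))%:E) +
   iid_expectation (fun x => (q x)%:E) (fun x => (N (t x - b))%:E))%E.
Proof.
move=> Nn mp mq p0 q0 pq q1 c0 nc qp mt.
rewrite !iid_expectationE; set nu := prod_measure _ _.
have mprod (f : 'rV[R]_d -> R) : measurable_fun setT f ->
    measurable_fun setT (fun x : n.-tuple 'rV[R]_d => \prod_(i < n) f (tnth x i)).
  move=> mf; apply: measurable_prod => i _.
  by apply: measurableT_comp => //; exact: measurable_tnth.
have mN z : measurable_fun setT (fun x => N (t x - z)).
  have cz := is_norm_subr_continuous _ _ _ z Nn.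
  exact: measurableT_comp (continuous_measurable_rV _ _ _ cz) mt.
pose s x := q x ^+ 2 / p x.
have s0 x : 0 <= s x by rewrite divr_ge0 // sqr_ge0.
have ms : measurable_fun setT s.
  apply: measurable_funM; first exact: measurable_funX.
  exact: measurable_ge0_inv mp p0.
pose P x := \prod_(i < n) p (tnth x i); pose Q x := \prod_(i < n) q (tnth x i).
pose S x := \prod_(i < n) s (tnth x i).
have P0 x : 0 <= P x by exact: prodr_ge0.
have Q0 x : 0 <= Q x by exact: prodr_ge0.
have S0 x : 0 <= S x by exact: prodr_ge0.
have SE x : S x = Q x ^+ 2 / P x.
  by rewrite /S /s /Q /P -prodfV -prodrXl -big_split.
have PQ x : P x = 0 -> Q x = 0.
  move=> /eqP/prodf_eq0[i _ /eqP/pq qi]; apply/eqP/prodf_eq0; exists i => //.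
  by rewrite qi.
pose D := N (b - a).
have D0 : 0 <= D by exact: is_norm_ge0.
have Dle x : D <= N (t x - a) + N (t x - b).
  have [ND _ _] := Nn; rewrite -(is_normN _ _ _ (t x - b)) // opprB.
  by rewrite addrC (le_trans _ (ND _ _)) // addrA subrK.
have IQ : (\int[nu]_x (Q x)%:E = 1)%E.
  rewrite (integral_prod_measure _ _ _ (lebesgue_rV R d) q n mq q0) q1.
  by rewrite -EFin_expe expr1n.
have IS : (\int[nu]_x (S x)%:E <= 2%:E)%E.
  rewrite (integral_prod_measure _ _ _ (lebesgue_rV R d) s n ms s0).
  have : (\int[lebesgue_rV R d]_x (s x)%:E <= (1 + c)%:E)%E by exact: qp.
  have : (0 <= \int[lebesgue_rV R d]_x (s x)%:E)%E.
    by apply: integral_ge0 => x _; rewrite lee_fin.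
  case: (integral _ _ _) => [u| |] //; rewrite !lee_fin => u0 uc.
  rewrite -EFin_expe lee_fin (le_trans _ (expr_le2 c n c0 nc)) //.
  by rewrite lerXn2r ?nnegrE // addr_ge0.
have mPN z : measurable_fun setT (fun x => (P x * N (t x - z))%:E).
  by apply/measurable_EFinP; apply: measurable_funM => //; exact: mprod.
have mQN z : measurable_fun setT (fun x => (Q x * N (t x - z))%:E).
  by apply/measurable_EFinP; apply: measurable_funM => //; exact: mprod.
have mQ : measurable_fun setT (EFin \o Q) by apply/measurable_EFinP; exact: mprod.
have mS : measurable_fun setT (EFin \o S) by apply/measurable_EFinP; exact: mprod.
have PN0 z x : (0 <= (P x * N (t x - z))%:E)%E.
  by rewrite lee_fin mulr_ge0 // is_norm_ge0.
have QN0 z x : (0 <= (Q x * N (t x - z))%:E)%E.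
  by rewrite lee_fin mulr_ge0 // is_norm_ge0.
have D40 : 0 <= D / 4 by rewrite divr_ge0.
have mDS : measurable_fun setT (fun x => ((D / 4)%:E * (S x)%:E)%E).
  by apply: emeasurable_funM => //; exact: measurable_cst.
have key : (\int[nu]_x (D%:E * (Q x)%:E) <= \int[nu]_x
    ((P x * N (t x - a))%:E + (Q x * N (t x - b))%:E + (D / 4)%:E * (S x)%:E))%E.
  apply: ge0_le_integral => //.
  - by move=> x _; rewrite mule_ge0 ?lee_fin.
  - by apply: emeasurable_funM => //; exact: measurable_cst.
  - by apply: emeasurable_funD => //; exact: emeasurable_funD.
  - move=> x _; rewrite -!EFinM -!EFinD lee_fin SE.
    by apply: two_point_pointwise => //; [exact: PQ|exact: is_norm_ge0|exact: is_norm_ge0].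
move: key; rewrite !ge0_integralD //;
  do ?[by move=> x _; rewrite adde_ge0|exact: emeasurable_funD
      |by move=> x _; rewrite mule_ge0 ?lee_fin].
rewrite !ge0_integralZl_EFin //; do ?[by move=> x _; rewrite lee_fin].
rewrite IQ mule1 => key.
pose I := (\int[nu]_x (P x * N (t x - a))%:E + \int[nu]_x (Q x * N (t x - b))%:E)%E.
have I0 : (0 <= I)%E by rewrite adde_ge0 // integral_ge0.
have {}key : (D%:E <= I + (D / 4)%:E * 2%:E)%E.
  by apply: (le_trans key); rewrite leeD2l // lee_wpmul2l ?lee_fin.
suff : ((D / 2)%:E <= I)%E by [].
clearbody I; case: I key I0 => [w| |] // key _; last by rewrite leey.
by move: key; rewrite -EFinM -EFinD !lee_fin; lra.
Qed.

(** For every estimator, the larger of the two risks is at least half of their sum. *)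
Lemma minimax_risk_two_point (N : 'rV[R]_d -> R) n (p q : 'rV[R]_d -> \bar R)
    (T : ('rV[R]_d -> \bar R) -> 'rV[R]_d) (c : R) :
  is_norm N -> bounded_density p -> bounded_density q ->
  (forall x, fine (p x) = 0 -> fine (q x) = 0) -> 0 <= c -> 2 * n%:R * c <= 1 ->
  (\int[mu]_x (fine (q x) ^+ 2 / fine (p x))%:E <= 1 + c%:E)%E ->
  ((N (T q - T p) / 4)%:E <=
   minimax_risk (fun x y => N (x - y)%R) n T [set p; q])%E.
Proof.
move=> Nn [[mp p0 p1] [Mp pM]] [[mq q0 q1] [Mq qM]] pq c0 nc qp.
have pE : p = fun x => (fine (p x))%:E.
  apply/funext => x; rewrite fineK // ge0_fin_numE //.
  by apply: le_lt_trans (pM x) _; rewrite ltry.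
have qE : q = fun x => (fine (q x))%:E.
  apply/funext => x; rewrite fineK // ge0_fin_numE //.
  by apply: le_lt_trans (qM x) _; rewrite ltry.
apply: le_ereal_inf_tmp => _ [t mt <-].
set E := fun q0 : 'rV[R]_d -> \bar R => iid_expectation q0 (fun x => (N (t x - T q0))%:E).
have H : ((N (T q - T p) / 2)%:E <= E p + E q)%E.
  rewrite /E [X in (_ <= iid_expectation X _ + _)%E]pE.
  rewrite [X in (_ <= _ + iid_expectation X _)%E]qE.
  apply: (two_point_expectation _ _ _ _ _ _ c) => //.
  - by apply: measurableT_comp mp; exact: fine_measurable.
  - by apply: measurableT_comp mq; exact: fine_measurable.
  - by move=> x; exact: fine_ge0 (p0 x).
  - by move=> x; exact: fine_ge0 (q0 x).
  - by rewrite -[RHS]q1; apply: eq_integral => x _; exact: (congr1 (fun F => F x) (esym qE)).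
have Ep : (E p <= ereal_sup [set E q0 | q0 in [set p; q]])%E.
  by apply: ereal_sup_ubound; exists p => //; left.
have Eq : (E q <= ereal_sup [set E q0 | q0 in [set p; q]])%E.
  by apply: ereal_sup_ubound; exists q => //; right.
have := le_trans H (leeD Ep Eq).
case: (ereal_sup _) => [w| |]; first by rewrite -EFinD !lee_fin; lra.
  by move=> _; rewrite leey.
by rewrite addNye leeNy_eq.
Qed.

(** Another representation with another minimizer would make both points maxima of the density, so
    [h] would agree at [f x] and at a different value of [f]; strictness at [f x] excludes this. *)
Lemma argmin_functional_unique (h : \bar R -> \bar R) (f : 'rV[R]_d -> \bar R) x :
  (forall y z : \bar R, (y <= z)%E -> (h z <= h y)%E) ->
  admissible f -> unique_min f x -> (forall z, z != f x -> h z != h (f x)) ->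
  argmins h (h \o f) x /\ argmin_functional h (h \o f) = x.
Proof.
move=> hd af fx hx; have ax : argmins h (h \o f) x by exists f.
split => //; have [f' af' [hff' fx']] := xgetPex 0 (ex_intro _ x ax).
rewrite -/(argmin_functional h (h \o f)) in fx'.
set x' := argmin_functional _ _ in fx' *.
apply/eqP; apply: contraT => x'x.
have h1 : (h (f x') <= h (f x))%E by apply: hd; apply/ltW/fx.
have h2 : (h (f x) <= h (f x'))%E.
  have E y : h (f y) = h (f' y) by have := congr1 (fun F => F y) hff'.
  by rewrite !E; apply: hd; apply/ltW/fx'; rewrite eq_sym.
have fx'x : f x' != f x by rewrite gt_eqF //; exact: fx.
by have := hx _ fx'x; rewrite eq_le h1 h2.
Qed.

End two_point.

(** * The risk bound at each large sample size *)

Section minimax_lower_bound.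
Context (R : realType) (d : nat) (h : \bar R -> \bar R).
Variables (g : 'rV[R]_d -> \bar R) (x0 : 'rV[R]_d).
Variables (N : 'rV[R]_d -> R).
Hypotheses (d0 : (0 < d)%N) (dh : decreasing_transformation d h).
Hypotheses (ga : admissible g) (gmodel : decreasing_model h (h \o g)).
Hypothesis gmin : unique_min g x0.
Let m := fine (g x0).
Hypotheses (hC1 : C1_at h m) (hm0 : derive1 (hreal h) m != 0) (Nn : is_norm N).
Let k := - derive1 (hreal h) m.
Let H := hreal h m.

Hypothesis gx0_fin : g x0 \is a fin_num.
Hypothesis gcont : forall e, 0 < e ->
  \forall x \near x0, (`|g x - g x0| <= e%:E)%E.

(** Within [e] of [m] the lower slope bound separates values; farther levels are compared through m
    - e or m + e by monotonicity. *)
Lemma hreal_strict (e y : R) :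
  (forall y z, m - e <= y -> y <= z -> z <= m + e ->
      k / 2 * (z - y) <= hreal h y - hreal h z <= 2 * k * (z - y)) -> 0 < k ->
  (forall y, `|y - m| <= e -> h y%:E \is a fin_num) ->
  m - e < y < m + e -> forall z, z != y%:E -> h z != h y%:E.
Proof.
move=> slope k0 hfin /andP[y1 y2] z zy.
have strict u v : m - e <= u -> u < v -> v <= m + e -> (h v%:E < h u%:E)%E.
  move=> u1 uv v2; have /andP[s1 _] := slope u v u1 (ltW uv) v2.
  have uf : h u%:E \is a fin_num.
    by apply: hfin; rewrite ler_distl; apply/andP; split; lra.
  have vf : h v%:E \is a fin_num.
    by apply: hfin; rewrite ler_distl; apply/andP; split; lra.
  rewrite -(fineK uf) -(fineK vf) lte_fin -subr_gt0; apply: lt_le_trans s1.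
  by rewrite mulr_gt0 ?divr_gt0 // subr_gt0.
have hd := dt_noninc dh.
have [zlt|zgt|zE] := ltgtP z y%:E; last by rewrite zE eqxx in zy.
- rewrite gt_eqF //; have [zl|zl] := leP z (m - e)%:E.
    by apply: lt_le_trans (hd _ _ zl); apply: strict => //; exact: ltW.
  case: z zy zlt zl => [w| |] // _; rewrite !lte_fin => zlt zl.
  by apply: strict => //; exact: ltW.
- rewrite lt_eqF //; have [zl|zl] := leP (m + e)%:E z.
    by apply: le_lt_trans (hd _ _ zl) _; apply: strict => //; exact: ltW.
  case: z zy zgt zl => [w| |] // _; rewrite !lte_fin => zlt zl.
  by apply: strict => //; exact: ltW.
Qed.

Lemma argmin_functional_base : argmins h (h \o g) x0 /\ argmin_functional h (h \o g) = x0.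
Proof.
have [k0 H0 [e [e0 hfin hlow hslope]]] := hreal_bilipschitz _ _ _ dh m hC1 hm0.
apply: argmin_functional_unique => //; first exact: dt_noninc dh.
rewrite -(fineK gx0_fin); apply: (hreal_strict e) => //.
by apply/andP; split; rewrite -/m; lra.
Qed.

Lemma sublevel_volume_small (G : 'M[R]_d) (tau : R) : posdefmx G -> 0 < tau ->
  exists2 e, 0 < e & forall eps, 0 < eps -> eps <= e -> sublevel_volume R d G eps <= tau.
Proof.
move=> Gp tau0; have dG : 0 < Num.sqrt (\det G).
  by rewrite sqrtr_gt0; exact: posdefmx_det_gt0.
pose u := Num.min 1 (tau * Num.sqrt (\det G)).
have u0 : 0 < u by rewrite lt_min ltr01 mulr_gt0.
(* 48 eps <= u^2 means 2 sqrt(12 eps) <= u. As u <= 1 and the dimension is positive, the [d]-th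
   power is at most its base. *)
exists (u ^+ 2 / 48); first by rewrite divr_gt0 ?exprn_gt0.
move=> eps eps0 epsu; rewrite /sublevel_volume ler_pdivrMr //.
have w0 : 0 <= 2 * Num.sqrt (12 * eps) by rewrite mulr_ge0 ?sqrtr_ge0.
have wu : 2 * Num.sqrt (12 * eps) <= u.
  rewrite -ler_sqr ?nnegrE ?(ltW u0) // exprMn sqr_sqrtr; last first.
    by rewrite mulr_ge0 ?(ltW eps0).
  by move: epsu; rewrite ler_pdivlMr //; lra.
have w1 : 2 * Num.sqrt (12 * eps) <= 1 by rewrite (le_trans wu) // ge_min lexx.
apply: (@le_trans _ _ (2 * Num.sqrt (12 * eps))).
  by rewrite -[leRHS]expr1 ler_wiXn2l.
by rewrite (le_trans wu) // ge_min lexx orbT.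
Qed.

(** The threshold [e0] is fixed before [eps] and [x1], which will move with the sample size. *)
Lemma perturbed_model (G : 'M[R]_d) : SC g x0 G ->
  exists2 e0, 0 < e0 & forall eps x1, 0 < eps -> eps <= e0 ->
    (g x1 <= (m + eps)%:E)%E ->
  exists p : 'rV[R]_d -> \bar R,
    [/\ decreasing_model h p, argmins h p !=set0, argmin_functional h p = x1,
      forall x, fine (h (g x)) = 0 -> fine (p x) = 0 &
      (\int[lebesgue_rV R d]_x (fine (p x) ^+ 2 / fine (h (g x)))%:E <=
        1 + (64 * k ^+ 2 * eps ^+ 2 / H * sublevel_volume R d G eps)%:E)%E].
Proof.
move=> [Gp [q [qNy qconv] gq]].
have [k0 H0 [e [e0 hfin hlow hslope]]] := hreal_bilipschitz _ _ _ dh m hC1 hm0.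
have ge : \forall x \near x0, (`|g x - g x0| <= (e / 2)%:E)%E.
  by apply: gcont; rewrite divr_gt0.
have [r' r'0 Hr'] := nbhs_gnorm _ _ _ _ _ Gp (filterI gq ge).
(* The gluing needs the quadratic decomposition up to radius 2 r. *)
pose r := r' / 2.
have r0 : 0 < r by rewrite divr_gt0.
have r2 : 2 * r = r' by rewrite /r; field.
have gfin x : gnorm G (x - x0) <= 2 * r -> g x \is a fin_num.
  rewrite r2 => /Hr'[_ /= gx].
  have : (`|g x - g x0| < +oo)%E by apply: le_lt_trans gx _; rewrite ltry.
  by rewrite -ge0_fin_numE // abse_fin_num fin_numB => /andP[].
have gq' x : gnorm G (x - x0) <= 2 * r ->
    g x = ((2^-1 * bform G (x - x0) (x - x0))%:E + q x)%E.
  by rewrite r2 => /Hr'[].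
have gle x : gnorm G (x - x0) <= r -> fine (g x) <= m + e / 2.
  move=> hx; have hx2 : gnorm G (x - x0) <= 2 * r by lra.
  have gf := gfin x hx2; move: hx2; rewrite r2 => /Hr'[_ /=].
  rewrite -(fineK gf) -(fineK gx0_fin) -EFinB abse_EFin lee_fin ler_distl.
  by case/andP.
have [W0 B0] : 0 < fine (lebesgue_rV R d (ellipsoid R G x0 ((r / 2) ^+ 2))) /\
    0 < fine (lebesgue_rV R d (ellipsoid R G x0 (r ^+ 2))).
  have pos s : 0 < s -> 0 < fine (lebesgue_rV R d (ellipsoid R G x0 (s ^+ 2))).
    move=> s0; rewrite fine_gt0 // (lebesgue_ellipsoid_gt0 _ _ x0 G Gp s s0) /=.
    have := lebesgue_ellipsoid_le _ _ G x0 (s ^+ 2) Gp (sqr_ge0 _).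
    by move=> /le_lt_trans; apply; rewrite ltry.
  by split; apply: pos => //; rewrite divr_gt0.
set vW := fine _ in W0; set vB := fine _ in B0.
have tau0 : 0 < vW ^+ 2 / (1024 * vB).
  by apply: divr_gt0; [exact: exprn_gt0|apply: mulr_gt0; rewrite ?ltr0n].
have [e1 e10 He1] := sublevel_volume_small G _ Gp tau0.
exists (Num.min (e / 4) (Num.min (r ^+ 2 / 8) e1)).
  by rewrite !lt_min e10 !divr_gt0 ?exprn_gt0.
move=> eps x1 eps0; rewrite !le_min => /andP[ee /andP[er ee1]] gx1.
have er8 : 8 * eps <= r ^+ 2 by move: er; rewrite ler_pdivlMr //; lra.
have gd : bounded_density (h \o g) by case: gmodel.
have [f [fa fmin fx1 fdens [fz fint]]] := perturbed_density R d h g x0 G q r dh ga gd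
  gmin Gp r0 qconv gfin gq' e k H e0 k0 H0 hfin hlow hslope gle N Nn
  eps x1 eps0 ee er8 gx1 (He1 eps eps0 ee1).
have [fam fT] : argmins h (h \o f) x1 /\ argmin_functional h (h \o f) = x1.
  apply: argmin_functional_unique => //; first exact: dt_noninc dh.
  rewrite fx1; apply: (hreal_strict e) => //.
  by rewrite -/m; apply/andP; split; lra.
exists (h \o f); split => //; last by exists x1.
by split => //; exists f.
Qed.

Variables (G : 'M[R]_d) (v : 'rV[R]_d) (L gamma s0 : R).
Hypotheses (GSC : SC g x0 G) (Nv : N v = 1).
Hypotheses (L0 : 0 < L) (gamma0 : 0 < gamma) (s00 : 0 < s0).
Hypothesis gholder : forall s, 0 < s -> s <= s0 ->
  (g (x0 + s *: v)%R <= (m + L * s `^ gamma)%:E)%E.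
Let X := H ^+ 2 / k ^+ 4 * \det G.

(** [eps] solves (48 eps)^(d+4) = X/n^2. As the volume bound contains (48 eps)^(d/2), the chi-square
    bound then equals 1/(36 n) in every dimension. The new minimizer is reached along [v] at the
    distance [delta] with L delta^gamma = eps. *)
Lemma minimax_risk_lower_bound : exists n0 : nat, forall n, (n0 <= n)%N ->
  exists p : 'rV[R]_d -> \bar R,
    [/\ decreasing_model h p, argmins h p !=set0 &
      ((4^-1 * (X `^ (1 / (d + 4)%:R) / (48 * L)) `^ gamma^-1)%:E <=
       (n%:R `^ (2 / (gamma * (d + 4)%:R)))%:E *
       minimax_risk (fun x y => N (x - y)%R) n (argmin_functional h) [set h \o g; p])%E].
Proof.
have [k0 H0 _] := hreal_bilipschitz _ _ _ dh m hC1 hm0.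
have [Gp _] := GSC.
have detG := posdefmx_det_gt0 _ _ _ Gp.
have X0 : 0 < X by rewrite mulr_gt0 // divr_gt0 ?exprn_gt0.
have [e0 e00 He0] := perturbed_model G GSC.
pose e1 := Num.min e0 (L * s0 `^ gamma).
have e10 : 0 < e1 by rewrite lt_min e00 mulr_gt0 // powR_gt0.
pose D : R := (d + 4)%:R.
have D0 : 0 < D by rewrite ltr0n addnS.
(* The condition eps <= e1 reads A <= n^2, and n >= A with n >= 1 suffices for it. *)
pose A := X / (48 * e1) ^+ (d + 4).
have c48 : 0 < 48 * e1 by rewrite mulr_gt0 ?ltr0n.
have A0 : 0 < A by rewrite divr_gt0 ?exprn_gt0.
exists (Num.truncn A).+1 => n nA.
have n1 : 1 <= n%:R :> R by rewrite ler1n (leq_trans _ nA).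
have n0 : 0 < n%:R :> R by lra.
have An : A <= n%:R.
  by rewrite (le_trans (ltW (truncnS_gt A))) // ler_nat.
pose Y := X / n%:R ^+ 2.
have Y0 : 0 < Y by rewrite divr_gt0 ?exprn_gt0.
pose eps := Y `^ (1 / D) / 48.
have eps0 : 0 < eps by rewrite divr_gt0 ?powR_gt0.
have YE : (Y `^ (1 / D)) ^+ (d + 4) = Y.
  by rewrite -powR_mulrn ?powR_ge0 // -powRrM div1r mulVf ?gt_eqF // powRr1 // ltW.
have eps_e1 : eps <= e1.
  rewrite ler_pdivrMr ?ltr0n // (mulrC e1).
  have d4 : (0 < d + 4)%N by rewrite addn_gt0 orbT.
  rewrite -(ler_pXn2r d4) ?nnegrE ?powR_ge0 ?(ltW c48) //.
  rewrite YE /Y ler_pdivrMr ?exprn_gt0 // (mulrC (_ ^+ (d + 4))) -ler_pdivrMr ?exprn_gt0 //.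
  apply: (le_trans An); rewrite expr2 ler_peMr // ltW.
pose delta := (eps / L) `^ gamma^-1.
have eL0 : 0 < eps / L by rewrite divr_gt0.
have delta0 : 0 < delta by rewrite powR_gt0.
have deltaE : L * delta `^ gamma = eps.
  rewrite /delta -powRrM mulVf ?gt_eqF // powRr1 ?(ltW eL0) //.
  by rewrite mulrC mulfVK // gt_eqF.
have delta_s0 : delta <= s0.
  have -> : s0 = (s0 `^ gamma) `^ gamma^-1.
    by rewrite -powRrM mulfV ?gt_eqF // powRr1 // ltW.
  apply: ge0_ler_powR; rewrite ?nnegrE ?invr_ge0 ?(ltW gamma0) ?(ltW eL0) ?powR_ge0 //.
  rewrite ler_pdivrMr // mulrC; apply: (le_trans eps_e1).
  by rewrite ge_min lexx orbT.
have gx1 : (g (x0 + delta *: v)%R <= (m + eps)%:E)%E.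
  by rewrite -deltaE; exact: gholder.
have [p [pm pa pT pz pI]] := He0 eps _ eps0
  (le_trans eps_e1 (ltac:(by rewrite ge_min lexx) : e1 <= e0)) gx1.
exists p; split => //.
pose c := 64 * k ^+ 2 * eps ^+ 2 / H * sublevel_volume R d G eps.
have c0 : 0 <= c.
  rewrite /c /sublevel_volume; apply: mulr_ge0.
    apply: divr_ge0; last exact: ltW.
    by apply: mulr_ge0; rewrite ?sqr_ge0 //; apply: mulr_ge0; rewrite ?sqr_ge0 ?ler0n.
  by rewrite divr_ge0 ?sqrtr_ge0 // exprn_ge0 // mulr_ge0 ?sqrtr_ge0.
have cE : c = (36 * n%:R)^-1.
  have s480 : 0 <= 12 * eps by rewrite mulr_ge0 ?ler0n // ltW.
  (* Comparing squares of nonnegative numbers avoids the half-integer power (48 eps)^(d/2). *)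
  have sq : c ^+ 2 = (36 * n%:R)^-1 ^+ 2.
    have e4 : (48 * eps) ^+ (d + 4) = Y.
      by rewrite /eps mulrC mulfVK ?pnatr_eq0 // YE.
    have e5 : (48 * eps) ^+ d = Y / (48 * eps) ^+ 4.
      by rewrite -e4 exprD mulfK // expf_neq0 // mulf_neq0 ?pnatr_eq0 // gt_eqF.
    have e6 : ((2 * Num.sqrt (12 * eps)) ^+ d) ^+ 2 = (48 * eps) ^+ d.
      rewrite exprAC; congr (_ ^+ _).
      by rewrite exprMn sqr_sqrtr //; ring.
    have -> : c ^+ 2 = (64 * k ^+ 2 * eps ^+ 2 / H) ^+ 2 *
        (((2 * Num.sqrt (12 * eps)) ^+ d) ^+ 2 / Num.sqrt (\det G) ^+ 2).
      by rewrite /c /sublevel_volume [LHS]exprMn; congr (_ * _); exact: expr_div_n.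
    rewrite (sqr_sqrtr (ltW detG)) e6 e5 /Y /X; field.
    by rewrite !gt_eqF.
  have n36 : 0 <= (36 * n%:R)^-1 :> R by rewrite invr_ge0 mulr_ge0 ?ler0n.
  by move/eqP: sq; rewrite eqrXn2 // => /eqP.
have nc : 2 * n%:R * c <= 1.
  rewrite cE -[2 * _]mulrC -mulrA; have -> : 2 * (36 * n%:R)^-1 = 18^-1 / n%:R :> R.
    by field; rewrite gt_eqF.
  by rewrite mulrCA mulfV ?gt_eqF // mulr1 invf_le1 ?ler1n ?ltr0n.
have gd : bounded_density (h \o g) by case: gmodel.
have pd : bounded_density p by case: pm.
have := minimax_risk_two_point R d N n (h \o g) p (argmin_functional h) c Nn gd pd pz c0 nc pI.
have [_ ->] := argmin_functional_base; rewrite pT.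
have -> : x0 + delta *: v - x0 = delta *: v by rewrite addrC addKr.
have [_ NZ _] := Nn; rewrite NZ Nv mulr1 ger0_norm ?(ltW delta0) // => risk.
have nn0 : 0 <= n%:R `^ (2 / (gamma * (d + 4)%:R)) :> R by exact: powR_ge0.
apply: le_trans (lee_wpmul2l _ risk); last by rewrite lee_fin.
(* The powers of [n] cancel exactly, so that an equality of constants remains. *)
rewrite -EFinM lee_fin le_eqVlt; apply/orP; left; apply/eqP.
rewrite [RHS]mulrA [LHS]mulrC; congr (_ * _); rewrite /delta.
have -> : 2 / (gamma * (d + 4)%:R) = 2 / D * gamma^-1.
  by rewrite /D; field; rewrite !gt_eqF.
rewrite (powRrM n%:R) -powRM ?powR_ge0 ?(ltW eL0) //; congr (_ `^ _).
rewrite /eps /Y.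
have -> : X / n%:R ^+ 2 = X * (n%:R `^ (- 2)).
  by rewrite powRN powR_mulrn ?(ltW n0).
rewrite powRM ?(ltW X0) ?powR_ge0 // -powRrM.
have -> : - 2 * (1 / D) = - (2 / D) by field; rewrite gt_eqF.
rewrite powRN; field.
by rewrite !gt_eqF // powR_gt0.
Qed.

End minimax_lower_bound.

(** * Limits and the Hoelder condition *)

Section limits.
Context (R : realType).

Lemma limn_einf_ge (u : nat -> \bar R) (a : \bar R) (n0 : nat) :
  (forall n, (n0 <= n)%N -> (a <= u n)%E) -> (a <= limn_einf u)%E.
Proof.
move=> au; rewrite limn_einf_lim; apply: lime_ge; first exact: is_cvg_einfs.
exists n0 => // n /= n0n; apply: le_ereal_inf_tmp => _ [k /= nk <-].
by apply: au; exact: leq_trans nk.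
Qed.

(* One sequence serves all levels [b] at once, which covers an infinite supremum. *)
Lemma nearly_optimal_choice (T : Type) (valid : T -> Prop) (F : nat -> T -> \bar R) :
  (exists t, valid t) -> exists s : nat -> T, (forall n, valid (s n)) /\
    forall (b : R) n0, 0 < b ->
      (forall n, (n0 <= n)%N -> exists2 t, valid t & (b%:E <= F n t)%E) ->
      exists n1, forall n, (n1 <= n)%N -> ((b / 2)%:E <= F n (s n))%E.
Proof.
move=> [t0 vt0].
have : forall n : nat, exists t, valid t /\ forall b : R, 0 < b -> b <= n%:R ->
    (exists2 t', valid t' & (b%:E <= F n t')%E) -> ((b / 2)%:E <= F n t)%E.
  move=> n; set S := ereal_sup [set F n t | t in valid].
  have ub t : valid t -> (F n t <= S)%E by move=> vt; apply: ereal_sup_ubound; exists t.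
  have [S0|S0] := leP S 0%E.
    exists t0; split => // b b0 _ [t' vt' bt'].
    have := le_trans (le_trans bt' (ub _ vt')) S0.
    by rewrite lee_fin leNgt b0.
  (* If the supremum is infinite, a value above [n] is taken; the restriction b <= n makes it large
     enough for all the levels concerned. *)
  have [Soo|Sfin] := eqVneq S +oo%E.
    have : (n%:R%:E < S)%E by rewrite Soo ltry.
    move=> /ereal_sup_gt[_ [t vt <-] nt]; exists t; split => // b b0 bn _.
    by apply: le_trans (ltW nt); rewrite lee_fin; lra.
  have Sf : S \is a fin_num.
    by rewrite fin_numE Sfin andbT gt_eqF // (lt_trans _ S0) // ltNy0.
  have : ((fine S / 2)%:E < S)%E.
    by move: S0; rewrite -(fineK Sf) !lte_fin /= => S0; lra.
  move=> /ereal_sup_gt[_ [t vt <-] St]; exists t; split => // b b0 _ [t' vt' bt'].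
  apply: le_trans (ltW St); rewrite lee_fin ler_pM2r ?invr_gt0 //.
  by rewrite -lee_fin fineK // (le_trans bt') // ub.
move=> /choice[s Hs]; exists s; split => [n|b n0 b0 Hb]; first by case: (Hs n).
exists (maxn n0 (Num.truncn b).+1) => n; rewrite geq_max => /andP[n0n bn].
have [_] := Hs n; apply => //; last exact: Hb.
by rewrite (le_trans (ltW (truncnS_gt b))) // ler_nat.
Qed.

Lemma powR_unbounded (a b e : R) : 0 < a -> 0 < b -> 0 < e ->
  forall A, 0 < A -> exists2 M, 0 < M & a * (b * M) `^ e = A.
Proof.
move=> a0 b0 e0 A A0; exists ((A / a) `^ e^-1 / b).
  by rewrite divr_gt0 // powR_gt0 // divr_gt0.
rewrite mulrC (mulrC b) mulfVK ?gt_eqF // -powRrM mulVf ?gt_eqF //.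
by rewrite powRr1 ?mulfVK ?gt_eqF // divr_ge0 // ltW.
Qed.

End limits.

(** * Consequences of the Hoelder condition at the minimum *)

Section hoelder_condition.
Context (R : realType) (d : nat).
Variables (g : 'rV[R]_d -> \bar R) (x0 : 'rV[R]_d) (N : 'rV[R]_d -> R).
Variables (L gamma : R).
Hypotheses (d0 : (0 < d)%N) (ga : admissible g) (gmin : unique_min g x0).
Hypotheses (Nn : is_norm N) (gamma0 : 0 < gamma).
Hypothesis gholder : \forall x \near x0,
  (`|g x - g x0| <= (L * N (x - x0) `^ gamma)%:E)%E.
Let m := fine (g x0).

Lemma unit_vector : exists v, N v = 1.
Proof.
have [_ NZ Nd] := Nn; pose w : 'rV[R]_d := delta_mx 0 (Ordinal d0).
have w0 : 0 < N w.
  rewrite lt_neqAle is_norm_ge0 // andbT eq_sym; apply/eqP => /Nd /rowP.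
  by move=> /(_ (Ordinal d0))/eqP; rewrite !mxE !eqxx oner_eq0.
exists ((N w)^-1 *: w); rewrite NZ ger0_norm ?invr_ge0 ?(ltW w0) //.
by rewrite mulVf // gt_eqF.
Qed.

(** In positive dimension there is another point, and its value is strictly larger. *)
Lemma unique_min_fin_num : g x0 \is a fin_num.
Proof.
have [[gNy _ _ _] _] := ga; have [v Nv] := unit_vector.
rewrite fin_numE gNy lt_eqF //; apply: lt_le_trans (gmin (x0 + v) _) (leey _).
apply/eqP => /(canRL (addKr _)); rewrite addNr => v0.
by move: Nv; rewrite v0 is_norm0 // => /eqP; rewrite eq_sym oner_eq0.
Qed.

Lemma hoelder_directional (v : 'rV[R]_d) : N v = 1 ->
  exists2 s0, 0 < s0 & forall s, 0 < s -> s <= s0 ->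
    (g (x0 + s *: v)%R <= (m + L * s `^ gamma)%:E)%E.
Proof.
move=> Nv; have [_ NZ _] := Nn.
have /nbhs_ballP[e /= e0 He] := gholder.
have v0 : 0 < 1 + `|v| by rewrite ltr_pwDl.
exists (e / 2 / (1 + `|v|)); first by rewrite !divr_gt0.
move=> s s0 se.
have : (`|g (x0 + s *: v)%R - g x0| <= (L * s `^ gamma)%:E)%E.
  have E : x0 + s *: v - x0 = s *: v by rewrite addrC addKr.
  have := He (x0 + s *: v); rewrite E NZ Nv mulr1 (gtr0_norm s0); apply.
  rewrite mx_norm_ball /ball_ /= -normrN opprB E mx_normZ gtr0_norm //.
  move: se; rewrite ler_pdivlMr // => se.
  by have := normr_ge0 v; nra.
rewrite -(fineK unique_min_fin_num) -/m.
case: (g (x0 + s *: v)%R) => [w| |]; last by rewrite leNye.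
  by rewrite -EFinB abse_EFin !lee_fin ler_norml => /andP[_]; lra.
by rewrite addye // gee0_abs ?leey // leye_eq.
Qed.

(** The minimum is strict, so [g] really increases along [v], which a nonpositive [L] would
    forbid. *)
Lemma hoelder_constant_gt0 : 0 < L.
Proof.
have [v Nv] := unit_vector; have [s0 s00 Hs] := hoelder_directional v Nv.
have := Hs s0 s00 (lexx _).
have : (g x0 < g (x0 + s0 *: v)%R)%E.
  apply: gmin; apply/eqP => /(canRL (addKr _)); rewrite addNr => /eqP.
  rewrite scaler_eq0 gt_eqF //= => /eqP v0.
  by move: Nv; rewrite v0 is_norm0 // => /eqP; rewrite eq_sym oner_eq0.
rewrite -{1}(fineK unique_min_fin_num) -/m => h1 h2.
have := lt_le_trans h1 h2; rewrite lte_fin ltrDl.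
by rewrite pmulr_lgt0 // powR_gt0.
Qed.

Lemma hoelder_continuous e : 0 < e -> \forall x \near x0, (`|g x - g x0| <= e%:E)%E.
Proof.
move=> e0; have L0 := hoelder_constant_gt0.
have [K K0 NK] := is_norm_le_mx_norm _ _ _ Nn.
pose t := (e / L) `^ gamma^-1.
have t0 : 0 < t by rewrite powR_gt0 // divr_gt0.
have near_t : \forall x \near x0, N (x - x0) <= t.
  apply/nbhs_ballP; exists (t / K) => /=; first exact: divr_gt0.
  move=> x; rewrite mx_norm_ball /ball_ /= distrC ltr_pdivlMr // mulrC => xt.
  exact: le_trans (NK _) (ltW xt).
apply: filterS2 near_t gholder => x xt gx; apply: le_trans gx _.
rewrite lee_fin mulrC -ler_pdivlMr //.
have -> : e / L = t `^ gamma.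
  by rewrite /t -powRrM mulVf ?gt_eqF // powRr1 // divr_ge0 // ltW.
by apply: ge0_ler_powR; rewrite ?nnegrE ?(ltW gamma0) ?is_norm_ge0 // ltW.
Qed.

(* By convexity g(x0 + s v) - g(x0) = O(s) = o(s^gamma). *)
Lemma hoelder_improve (v : 'rV[R]_d) (L' : R) : N v = 1 -> gamma < 1 -> 0 < L' ->
  exists2 s0, 0 < s0 & forall s, 0 < s -> s <= s0 ->
    (g (x0 + s *: v)%R <= (m + L' * s `^ gamma)%:E)%E.
Proof.
move=> Nv gamma1 L'0; have [s1 s10 Hs] := hoelder_directional v Nv.
have L0 := hoelder_constant_gt0.
(* [M] is the slope of the bound over the chord of length [s1]; [t] is chosen so that M s^(1 -
   gamma) <= L' for s <= t. *)
pose M := L * s1 `^ gamma / s1.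
have M0 : 0 < M by rewrite divr_gt0 // mulr_gt0 // powR_gt0.
pose t := (L' / M) `^ (1 - gamma)^-1.
have g10 : 0 < 1 - gamma by lra.
have t0 : 0 < t by rewrite powR_gt0 // divr_gt0.
exists (Num.min s1 t); first by rewrite lt_min s10.
move=> s s0; rewrite le_min => /andP[ss1 st].
have [[_ _ gconv _] _] := ga.
have a01 : 0 <= s / s1 <= 1 by rewrite ler_pdivrMr // mul1r ss1 divr_ge0 // ltW.
have := gconv (x0 + s1 *: v) x0 (s / s1) a01.
have -> : (s / s1) *: (x0 + s1 *: v) + (1 - s / s1) *: x0 = x0 + s *: v.
  by apply/rowP => i; rewrite !mxE; field; rewrite gt_eqF.
move=> /le_trans; apply.
apply: (@le_trans _ _ ((s / s1)%:E * (m + L * s1 `^ gamma)%:E + (1 - s / s1)%:E * m%:E)%E).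
  rewrite fineK ?unique_min_fin_num // leeD2r // lee_wpmul2l ?lee_fin //.
    by case/andP: a01.
  exact: Hs.
rewrite -!EFinM -EFinD lee_fin.
have -> : s / s1 * (m + L * s1 `^ gamma) + (1 - s / s1) * m = m + s * M.
  by rewrite /M; field; rewrite gt_eqF.
rewrite lerD2l.
have -> : s * M = M * s `^ (1 - gamma) * s `^ gamma.
  by rewrite -mulrA -powRD ?subrK ?powRr1 1?mulrC // ?(ltW s0) // oner_eq0.
rewrite ler_wpM2r ?powR_ge0 // mulrC -ler_pdivlMr //.
have -> : L' / M = t `^ (1 - gamma).
  by rewrite /t -powRrM mulVf ?gt_eqF // powRr1 // divr_ge0 // ltW.
by apply: ge0_ler_powR; rewrite ?nnegrE // ltW.
Qed.

(* For [gamma < 1] the constant [96^(-1/gamma)] is absorbed by decreasing [L],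
   so that the final constant depends on [d] only. *)
Lemma hoelder_constant (v : 'rV[R]_d) : N v = 1 -> exists L' s0, [/\ 0 < L', 0 < s0,
    96^-1 * L `^ (- gamma^-1) <= (96 * L') `^ (- gamma^-1) &
    forall s, 0 < s -> s <= s0 ->
      (g (x0 + s *: v)%R <= (m + L' * s `^ gamma)%:E)%E].
Proof.
move=> Nv; have L0 := hoelder_constant_gt0.
have [gamma1|gamma1] := ltP gamma 1.
  have L'0 : 0 < L / 96 by rewrite divr_gt0 ?ltr0n.
  have [s0 s00 Hs] := hoelder_improve v (L / 96) Nv gamma1 L'0.
  exists (L / 96), s0; split => //.
  have -> : 96 * (L / 96) = L by field.
  by rewrite ler_piMl ?powR_ge0 // invf_le1 ?ltr0n ?ler1n.
have [s0 s00 Hs] := hoelder_directional v Nv.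
exists L, s0; split => //.
rewrite powRM ?ler0n ?(ltW L0) // ler_wpM2r ?powR_ge0 // powRN.
rewrite lef_pV2 ?posrE ?powR_gt0 ?ltr0n //.
rewrite -[leRHS](@powRr1 _ 96) ?ler0n //.
by apply: ler_powR; rewrite ?ler1n // invf_le1.
Qed.

End hoelder_condition.

(** * Passage to the limit and to the supremum over the curvature *)

Theorem theorem2p26 (R : realType) (d : nat) (hd : (1 <= d)%N) :
  exists2 C : R, 0 < C &
  forall (h : \bar R -> \bar R) (g : 'rV[R]_d -> \bar R) (x0 : 'rV[R]_d)
    (N : 'rV[R]_d -> R) (L gamma : R),
  decreasing_transformation d h ->
  admissible g ->
  decreasing_model h (h \o g) ->
  relint (edom g) x0 ->
  unique_min g x0 ->
  C1_at h (fine (g x0)) ->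
  derive1 (hreal h) (fine (g x0)) != 0 ->
  (0 < curv x0 g)%E ->
  is_norm N ->
  0 < gamma ->
  (\forall x \near x0,
     (`|g x - g x0| <= (L * N (x - x0) `^ gamma)%:E)%E) ->
  exists p : nat -> 'rV[R]_d -> \bar R,
    (forall n, decreasing_model h (p n) /\ argmins h (p n) !=set0) /\
    ((C * L `^ (- gamma^-1))%R%:E *
     poweR
       ((hreal h (fine (g x0)) ^+ 2 / derive1 (hreal h) (fine (g x0)) ^+ 4)%R%:E *
        curv x0 g)
       (1 / (gamma * (d + 4)%:R))
     <= limn_einf (fun n : nat =>
          (n%:R `^ (2 / (gamma * (d + 4)%:R)))%R%:E *
          minimax_risk (fun x y => N (x - y)%R) n (argmin_functional h)
            [set h \o g; p n]))%E.
Proof.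
have c96 : 0 < 96^-1 :> R by rewrite invr_gt0 ltr0n.
(* 1/8 is 1/4 from the two-point bound times 1/2 from the nearly optimal choice. 96 is 48, from the
   choice of eps, doubled because the determinant only exceeds half of the target [M]. *)
exists (8^-1 * 96^-1); first by rewrite mulr_gt0 // invr_gt0 ltr0n.
move=> h g x0 N L gamma dh ga gmodel _ gmin hC1 hm0 curv0 Nn gamma0 gholder.
have gfin := unique_min_fin_num _ _ _ _ _ hd ga gmin Nn.
have L0 := hoelder_constant_gt0 _ _ _ _ _ _ _ hd ga gmin Nn gholder.
have gcont := hoelder_continuous _ _ _ _ _ _ _ hd ga gmin Nn gamma0 gholder.
have [v Nv] := unit_vector _ _ _ hd Nn.
have [L' [s0 [L'0 s00 LL' Hs]]] :=
  hoelder_constant _ _ _ _ _ _ _ hd ga gmin Nn gamma0 gholder v Nv.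
have [k0 H0 _] := hreal_bilipschitz _ _ _ dh _ hC1 hm0.
set m := fine (g x0) in hC1 hm0 k0 H0 Hs *.
have [base _] := argmin_functional_base _ _ _ _ _ dh ga gmin hC1 hm0 gfin.
pose D : R := (d + 4)%:R; have D0 : 0 < D by rewrite ltr0n addn_gt0 orbT.
pose F n p := ((n%:R `^ (2 / (gamma * D)))%:E *
  minimax_risk (fun x y => N (x - y)%R) n (argmin_functional h) [set h \o g; p])%E.
(* The sequence is fixed here, before any [G]; [h \o g] itself shows that candidates exist. *)
have [p [pvalid pF]] := nearly_optimal_choice R _
  (fun p => decreasing_model h p /\ argmins h p !=set0) F
  (ex_intro _ (h \o g) (conj gmodel (ex_intro _ x0 base))).
exists p; split => //.
rewrite -/D -[X in (_ <= limn_einf X)%E]/(fun n => F n (p n)).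
set a := hreal h m ^+ 2 / derive1 (hreal h) m ^+ 4.
have aE : a = hreal h m ^+ 2 / (- derive1 (hreal h) m) ^+ 4.
  by rewrite /a; congr (_ / _); ring.
have a0 : 0 < a by rewrite aE divr_gt0 // exprn_gt0.
pose e := 1 / (gamma * D).
have e0 : 0 < e by rewrite divr_gt0 // mulr_gt0.
have D1 : D^-1 <= 1 by rewrite invf_le1 // ler1n addn_gt0 orbT.
(* With [M / 2] in the hypothesis, a finite positive curvature can itself be taken for [M] even if
   the supremum is not attained, and every [M] is allowed when it is infinite. *)
have bound M : 0 < M -> ((M / 2)%:E < curv x0 g)%E ->
    ((8^-1 * 96^-1 * L `^ (- gamma^-1) * (a * M) `^ e)%:E <=
     limn_einf (fun n => F n (p n)))%E.
  move=> M0 Mcurv.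
  have [G GSC Gdet] : exists2 G, SC g x0 G & M / 2 < \det G.
    move: Mcurv; rewrite /curv; case: ifPn => [_|_].
      by rewrite lte_fin ltNge divr_ge0 // ltW.
    by move=> /ereal_sup_gt[_ [G GSC <-]]; rewrite lte_fin; exists G.
  have [n0 Hn0] := minimax_risk_lower_bound _ _ _ _ _ _ hd dh ga gmodel gmin hC1 hm0 Nn
    gfin gcont G v L' gamma s0 GSC Nv L'0 gamma0 s00 Hs.
  set b := 4^-1 * _ in Hn0.
  have G0 : 0 < \det G by apply: lt_trans Gdet; rewrite divr_gt0.
  have X0 : 0 < hreal h m ^+ 2 / (- derive1 (hreal h) m) ^+ 4 * \det G.
    by rewrite -aE mulr_gt0.
  have b0 : 0 < b.
    rewrite mulr_gt0 ?invr_gt0 ?ltr0n // powR_gt0 // divr_gt0 ?powR_gt0 //.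
    by rewrite mulr_gt0 ?ltr0n.
  have Hb n : (n0 <= n)%N -> exists2 q, decreasing_model h q /\ argmins h q !=set0 &
      (b%:E <= F n q)%E by move=> /Hn0[q [qm qa qb]]; exists q.
  have [n1 Hn1] := pF b n0 b0 Hb.
  apply: le_trans (limn_einf_ge _ _ _ _ Hn1); rewrite lee_fin.
  (* The factor 1/2 lost in the determinant appears with exponent 1/D, and 2^(-1/D) >= 1/2. *)
  have step1 : (a * M) `^ D^-1 / (96 * L') <=
      (hreal h m ^+ 2 / (- derive1 (hreal h) m) ^+ 4 * \det G) `^ (1 / D) / (48 * L').
    rewrite -aE div1r.
    have -> : 96 * L' = 2 * (48 * L') by ring.
    have i48 : 0 <= (48 * L')^-1 by rewrite invr_ge0 mulr_ge0 ?ler0n // ltW.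
    have i2 : 0 <= 2^-1 :> R by rewrite invr_ge0.
    have aM0 : 0 <= a * M by rewrite mulr_ge0 // ltW.
    rewrite invfM mulrA; apply: (ler_wpM2r i48).
    apply: (@le_trans _ _ ((a * M) `^ D^-1 * 2^-1 `^ D^-1)).
      rewrite ler_wpM2l ?powR_ge0 // -[leLHS](@powRr1 _ 2^-1) ?invr_ge0 //.
      by apply: ger_powR => //; rewrite invr_gt0 ltr0n /= invf_le1 ?ler1n.
    rewrite -powRM //.
    have h1 : a * M * 2^-1 <= a * \det G.
      by rewrite -mulrA ler_wpM2l ?(ltW a0) // ltW.
    have h0 : 0 < a * M * 2^-1 by rewrite mulr_gt0 ?invr_gt0 // mulr_gt0.
    apply: ge0_ler_powR h1.
    - by rewrite invr_ge0 ltW.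
    - by rewrite nnegrE ltW.
    - by rewrite nnegrE mulr_ge0 // ltW.
  have step2 : ((a * M) `^ D^-1 / (96 * L')) `^ gamma^-1 =
      (a * M) `^ e * (96 * L') `^ (- gamma^-1).
    have l96 : 0 <= 96 * L' by rewrite mulr_ge0 ?ler0n // ltW.
    rewrite powRM ?powR_ge0 ?invr_ge0 // -powRrM; congr (_ `^ _ * _).
      by rewrite /e; field; rewrite !gt_eqF.
    by rewrite -(powR_inv1 l96) -powRrM mulN1r.
  have step3 : ((a * M) `^ D^-1 / (96 * L')) `^ gamma^-1 <= 4 * b.
    rewrite /b mulVKf ?pnatr_eq0 //; apply: ge0_ler_powR step1.
    - by rewrite invr_ge0 ltW.
    - by rewrite nnegrE divr_ge0 ?powR_ge0 // mulr_ge0 ?ler0n // ltW.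
    - by rewrite nnegrE divr_ge0 ?powR_ge0 // mulr_ge0 ?ler0n // ltW.
  rewrite step2 in step3.
  have := ler_wpM2l (powR_ge0 (a * M) e) LL'; lra.
move: curv0 bound; rewrite -/e; case: (curv x0 g) => [c| |] // curv0 bound.
  have -> : poweR (a%:E * c%:E) e = ((a * c) `^ e)%:E by rewrite -EFinM poweR_EFin.
  rewrite -EFinM; apply: bound; first by rewrite -lte_fin.
  by rewrite lte_fin; rewrite lte_fin in curv0; lra.
suff -> : limn_einf (fun n => F n (p n)) = +oo%E by exact: leey.
apply/eqyP => A A0.
have C0 : 0 < 8^-1 * 96^-1 * L `^ (- gamma^-1).
  by rewrite mulr_gt0 ?powR_gt0 // mulr_gt0 // invr_gt0 ltr0n.
have [M M0 <-] := powR_unbounded R _ a e C0 a0 e0 A A0.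
by apply: bound => //; exact: ltry.
Qed.
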